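(* Consider the linear time-varying stochastic system with unknown inputs described in the context. Let the initial state estimate $\hat x_{0|0}$ be unbiased. If $\mathrm{rk}(C_{2,k}G_{2,k-1})=p-p_{H_{k-1}}$ (for all $k\ge1$), then the ULISE and PLISE algorithms both provide the unbiased, best linear estimate (BLUE) of the unknown input and the minimum-variance unbiased estimate of the system states.
   Context: System: $x_{k+1}=A_kx_k+B_ku_k+G_kd_k+w_k$, $y_k=C_kx_k+D_ku_k+H_kd_k+v_k$, with state $x_k\in\mathbb{R}^n$, known input $u_k\in\mathbb{R}^m$, unknown arbitrary input $d_k\in\mathbb{R}^p$, measurement $y_k\in\mathbb{R}^l$; $w_k,v_k$ are mutually uncorrelated, zero-mean, white, with known covariances $Q_k\succeq0$, $R_k\succ0$; $x_0$ is independent of all $w_k,v_k$. All matrices are known and bounded; $n\ge l\ge1$, $l\ge p\ge0$, $m\ge 0$, $\max_k\mathrm{rk}[G_k^\top\ H_k^\top]=p$; no assumption on the rank of $H_k$. Transformation: $p_{H_k}=\mathrm{rk}(H_k)$; SVD $H_k=\begin{bmatrix}U_{1,k}&U_{2,k}\end{bmatrix}\begin{bmatrix}\Sigma_k&0\\ 0&0\end{bmatrix}\begin{bmatrix}V_{1,k}^\top\\ V_{2,k}^\top\end{bmatrix}$, $\Sigma_k\in\mathbb{R}^{p_{H_k}\times p_{H_k}}$ diagonal of full rank, $[U_{1,k}\ U_{2,k}]$ and $V_k=[V_{1,k}\ V_{2,k}]$ unitary. $d_{i,k}=V_{i,k}^\top d_k$, $G_{i,k}=G_kV_{i,k}$ ($i=1,2$);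 $T_{1,k}=U_{1,k}^\top-U_{1,k}^\top R_kU_{2,k}(U_{2,k}^\top R_kU_{2,k})^{-1}U_{2,k}^\top$, $T_{2,k}=U_{2,k}^\top$; $z_{i,k}=T_{i,k}y_k$, $C_{i,k}=T_{i,k}C_k$, $D_{i,k}=T_{i,k}D_k$, $v_{i,k}=T_{i,k}v_k$, $R_{i,k}=T_{i,k}R_kT_{i,k}^\top$. Thus $z_{1,k}=C_{1,k}x_k+D_{1,k}u_k+\Sigma_kd_{1,k}+v_{1,k}$, $z_{2,k}=C_{2,k}x_k+D_{2,k}u_k+v_{2,k}$. Operations with empty matrices are allowed; $^\dagger$ is the Moore-Penrose pseudoinverse. Three-step filter (for $k\ge1$): $\hat x_{k|k-1}=A_{k-1}\hat x_{k-1|k-1}+B_{k-1}u_{k-1}+G_{1,k-1}\hat d_{1,k-1}$; $\hat d_{2,k-1}=M_{2,k}(z_{2,k}-C_{2,k}\hat x_{k|k-1}-D_{2,k}u_k)$; $\hat d_{k-1}=V_{1,k-1}\hat d_{1,k-1}+V_{2,k-1}\hat d_{2,k-1}$; $\hat x^\star_{k|k}=\hat x_{k|k-1}+G_{2,k-1}\hat d_{2,k-1}$; $\hat x_{k|k}=\hat x^\star_{k|k}+L_k(y_k-C_k\hat x^\star_{k|k}-D_ku_k)$; and $\hat d_{1,k}=M_{1,k}(z_{1,k}-C_{1,k}\hat x_{k|k}-D_{1,k}u_k)$ in ULISE, $\hat d_{1,k}=M_{1,k}(z_{1,k}-C_{1,k}\hat x^\star_{k|k}-D_{1,k}u_k)$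 in PLISE. Gains common to both algorithms: $M_{1,k}=\Sigma_k^{-1}$; $\hat A_k=A_k-G_{1,k}M_{1,k}C_{1,k}$; $\hat Q_k=G_{1,k}M_{1,k}R_{1,k}M_{1,k}^\top G_{1,k}^\top+Q_k$; $\tilde P_k=\hat A_{k-1}P^x_{k-1|k-1}\hat A_{k-1}^\top+\hat Q_{k-1}$; $\tilde R_{2,k}=C_{2,k}\tilde P_kC_{2,k}^\top+R_{2,k}$; $P^d_{2,k-1}=(G_{2,k-1}^\top C_{2,k}^\top\tilde R_{2,k}^{-1}C_{2,k}G_{2,k-1})^{-1}$; $M_{2,k}=P^d_{2,k-1}G_{2,k-1}^\top C_{2,k}^\top\tilde R_{2,k}^{-1}$; $\tilde R^\star_k=C_kP^{\star x}_{k|k}C_k^\top+R_k-C_kG_{2,k-1}M_{2,k}U_{2,k}^\top R_k-R_kU_{2,k}M_{2,k}^\top G_{2,k-1}^\top C_k^\top$; $K_k=P^{\star x}_{k|k}C_k^\top-G_{2,k-1}M_{2,k}U_{2,k}^\top R_k$; $M^\star_{1,k}=\Sigma_k^{-1}(U_{1,k}^\top\tilde R_k^{\star\dagger}U_{1,k})^{-1}U_{1,k}^\top\tilde R_k^{\star\dagger}$; $L_k=K_k(I_l-U_{1,k}\Sigma_kM^\star_{1,k})^\top\tilde R_k^{\star\dagger}$; $P^x_{k|k}=(I-L_kC_k)P^{\star x}_{k|k}(I-L_kC_k)^\top+L_kR_kL_k^\top+(I-L_kC_k)G_{2,k-1}M_{2,k}U_{2,k}^\top R_kL_k^\top+L_kR_kU_{2,k}M_{2,k}^\top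 G_{2,k-1}^\top(I-L_kC_k)^\top$. In ULISE: $P^{\star x}_{k|k}=G_{2,k-1}M_{2,k}R_{2,k}M_{2,k}^\top G_{2,k-1}^\top+(I-G_{2,k-1}M_{2,k}C_{2,k})\tilde P_k(I-G_{2,k-1}M_{2,k}C_{2,k})^\top$. In PLISE: $P^d_{1,k}=M_{1,k}(C_{1,k}P^{\star x}_{k|k}C_{1,k}^\top+R_{1,k})M_{1,k}$; $P^{xd}_{1,k}=-(I-L_kC_k)P^{\star x}_{k|k}C_{1,k}^\top M_{1,k}^\top-L_kR_kT_{2,k}^\top M_{2,k}^\top G_{2,k-1}^\top C_{1,k}^\top M_{1,k}^\top$ for $k\ge1$; $P^{xd}_{2,k-1}=-P^x_{k-1|k-1}A_{k-1}^\top C_{2,k}^\top M_{2,k}^\top-P^{xd}_{1,k-1}G_{1,k-1}^\top C_{2,k}^\top M_{2,k}^\top$; $P^d_{12,k-1}=-P^{xd\,\top}_{1,k-1}A_{k-1}^\top C_{2,k}^\top M_{2,k}^\top-P^d_{1,k-1}G_{1,k-1}^\top C_{2,k}^\top M_{2,k}^\top$; and $P^{\star x}_{k|k}=\begin{bmatrix}A_{k-1}&G_{1,k-1}&G_{2,k-1}\end{bmatrix}\begin{bmatrix}P^x_{k-1|k-1}&P^{xd}_{1,k-1}&P^{xd}_{2,k-1}\\ P^{xd\,\top}_{1,k-1}&P^d_{1,k-1}&P^d_{12,k-1}\\ P^{xd\,\top}_{2,k-1}&P^{d\,\top}_{12,k-1}&P^d_{2,k-1}\end{bmatrix}\begin{bmatrix}A_{k-1}^\top\\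 G_{1,k-1}^\top\\ G_{2,k-1}^\top\end{bmatrix}+Q_{k-1}-G_{2,k-1}M_{2,k}C_{2,k}Q_{k-1}-Q_{k-1}C_{2,k}^\top M_{2,k}^\top G_{2,k-1}^\top$. Initialization: $\hat x_{0|0}=\mathbb{E}[x_0]$ with error covariance $P^x_{0|0}=\mathcal{P}^x_0$; in PLISE also $\hat x^\star_{0|0}=\mathbb{E}[x_0]$, $P^{\star x}_{0|0}=\mathcal{P}^x_0$, $P^{xd}_{1,0}=-P^{\star x}_{0|0}C_{1,0}^\top\Sigma_0^{-1}$; $\hat d_{1,0}=\Sigma_0^{-1}(z_{1,0}-C_{1,0}\hat x_{0|0}-D_{1,0}u_0)$. Meaning of the conclusion, for filters of the three-step recursive form $\hat x_{k|k-1}=A_{k-1}\hat x_{k-1|k-1}+B_{k-1}u_{k-1}+G_{1,k-1}\hat d_{1,k-1}$, $\hat d_{2,k-1}=M_{2,k}(z_{2,k}-C_{2,k}\hat x_{k|k-1}-D_{2,k}u_k)$, $\hat d_{k-1}=V_{1,k-1}\hat d_{1,k-1}+V_{2,k-1}\hat d_{2,k-1}$, $\hat x^\star_{k|k}=\hat x_{k|k-1}+G_{2,k-1}\hat d_{2,k-1}$, $\hat x_{k|k}=\hat x^\star_{k|k}+L_k(y_k-C_k\hat x^\star_{k|k}-D_ku_k)$, with $\hat d_{1,k}=M_{1,k}(z_{1,k}-C_{1,k}\hat x_{k|k}-D_{1,k}u_k)$ (ULISE) or $\hat d_{1,k}=M_{1,k}(z_{1,k}-C_{1,k}\hat x^\star_{k|k}-D_{1,k}u_k)$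 (PLISE): estimates are unbiased if the expected errors $\mathbb{E}[x_k-\hat x_{k|k}]$, $\mathbb{E}[d_k-\hat d_k]$ vanish for all unknown inputs. The input estimate is BLUE if it is a linear unbiased estimate with the lowest mean squared error, i.e. $M_{1,k},M_{2,k}$ give unbiased estimates of $d_{1,k}$, $d_{2,k-1}$ that are linear in the corresponding residuals $z_{1,k}-C_{1,k}\hat x_{k|k}-D_{1,k}u_k$ (ULISE) or $z_{1,k}-C_{1,k}\hat x^\star_{k|k}-D_{1,k}u_k$ (PLISE), and $z_{2,k}-C_{2,k}\hat x_{k|k-1}-D_{2,k}u_k$, with minimal mean squared error. The state estimate is minimum-variance unbiased if $L_k$ minimizes the trace of the state error covariance $\mathbb{E}[(x_k-\hat x_{k|k})(x_k-\hat x_{k|k})^\top]$ among gains giving an unbiased state estimate.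
   Formalization: In PLISE, the formula for P̃_k is replaced by [A G_1][[P^x, P^xd_1],[P^xd_1^T, P^d_1]][A G_1]^T + Q (all at k-1), the true prediction-error covariance; with the stated common formula PLISE's M_{2,k} need not be BLUE. ULISE is unchanged. *)

(* Defs.v *)
(* MathComp world, with MathComp-Analysis for the probability layer. *)
From HB Require Import structures.
From mathcomp Require Import all_boot all_order all_algebra.
From mathcomp Require Import all_classical all_reals all_analysis.
Set Implicit Arguments.
Unset Strict Implicit.
Unset Printing Implicit Defensive.
Import Order.TTheory GRing.Theory Num.Theory.
Local Open Scope classical_set_scope.
Local Open Scope ring_scope.

Section LinearAlgebra.
Context {R : realType}.

Definition psdmx q (M : 'M[R]_q) : Prop :=
  M^T = M /\ forall x : 'cV[R]_q, 0 <= (x^T *m M *m x) 0 0.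

Definition pdmx q (M : 'M[R]_q) : Prop :=
  M^T = M /\ forall x : 'cV[R]_q, x != 0 -> 0 < (x^T *m M *m x) 0 0.

Definition bounded_mxseq q r (M : nat -> 'M[R]_(q, r)) : Prop :=
  exists c : R, forall k i j, `|M k i j| <= c.

Definition penrose q r (M : 'M[R]_(q, r)) (X : 'M[R]_(r, q)) : Prop :=
  [/\ M *m X *m M = M, X *m M *m X = X,
      (M *m X)^T = M *m X & (X *m M)^T = X *m M].

(* Moore-Penrose pseudoinverse: the matrix satisfying the Penrose equations,
   which always exists and is unique. *)
Definition mpinv q r (M : 'M[R]_(q, r)) : 'M[R]_(r, q) :=
  xget 0 [set X | penrose M X].

End LinearAlgebra.

Section Probability.
Context {d : measure_display} {T : measurableType d} {R : realType}.
Variable P : probability T R.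

Definition measurable_vec q (X : T -> 'cV[R]_q) : Prop :=
  forall i, measurable_fun [set: T] (fun t => X t i 0).

Definition L2_vec q (X : T -> 'cV[R]_q) : Prop :=
  forall i, (fun t => X t i 0) \in Lfun P 2%:E.

Definition zero_mean q (X : T -> 'cV[R]_q) : Prop :=
  forall i, (fun t => X t i 0) \in Lfun P 1 /\
            ('E_P[(fun t => X t i 0)%R] = 0)%E.

Definition has_cov q r (X : T -> 'cV[R]_q) (Y : T -> 'cV[R]_r)
    (M : 'M[R]_(q, r)) : Prop :=
  forall i j, covariance P (fun t => X t i 0) (fun t => Y t j 0) = (M i j)%:E.

Definition sigma_vec q (X : T -> 'cV[R]_q) : set (set T) :=
  <<s [set E : set T | exists (i : 'I_q) (U : set R), measurable U /\
                         E = (fun t => X t i 0) @^-1` U] >>.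

Definition independent_vec q r (X : T -> 'cV[R]_q) (Y : T -> 'cV[R]_r) : Prop :=
  forall E F : set T, sigma_vec X E -> sigma_vec Y F ->
    P (E `&` F) = (P E * P F)%E.

(* Extended-real valued, so that an infinite mean squared error counts as
   infinite. *)
Definition mse q (e : T -> 'cV[R]_q) : \bar R :=
  ('E_P[(fun t => ((e t)^T *m e t) 0 0)%R])%E.

Definition trace_cov q (e : T -> 'cV[R]_q) : \bar R :=
  (\sum_(i < q) 'E_P[(fun t => (e t *m (e t)^T) i i)%R])%E.

End Probability.

Section System.
Context {R : realType} {n m p l : nat}.

Record system := System {
  sysA : nat -> 'M[R]_n;
  sysB : nat -> 'M[R]_(n, m);
  sysG : nat -> 'M[R]_(n, p);
  sysC : nat -> 'M[R]_(l, n);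
  sysD : nat -> 'M[R]_(l, m);
  sysH : nat -> 'M[R]_(l, p);
  sysQ : nat -> 'M[R]_n;
  sysR : nat -> 'M[R]_l }.

Record svd_factors (H : nat -> 'M[R]_(l, p)) := SvdFactors {
  svdU1 : forall k, 'M[R]_(l, \rank (H k));
  svdU2 : forall k, 'M[R]_(l, l - \rank (H k));
  svdS  : forall k, 'M[R]_(\rank (H k));
  svdV1 : forall k, 'M[R]_(p, \rank (H k));
  svdV2 : forall k, 'M[R]_(p, p - \rank (H k)) }.

(* A row_mx is not square by type, so orthogonality is stated on both sides. *)
Definition is_svd H (s : svd_factors H) : Prop :=
  forall k,
    let U := row_mx (svdU1 s k) (svdU2 s k) in
    let V := row_mx (svdV1 s k) (svdV2 s k) in
    [/\ U *m U^T = 1%:M /\ U^T *m U = 1%:M,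
        V *m V^T = 1%:M /\ V^T *m V = 1%:M,
        is_diag_mx (svdS s k), svdS s k \in unitmx
      & H k = U *m block_mx (svdS s k) 0 0 0 *m V^T].

Context (S : system) (s : svd_factors (sysH S)).

Local Notation A := (sysA S).
Local Notation B := (sysB S).
Local Notation C := (sysC S).
Local Notation D := (sysD S).
Local Notation Q := (sysQ S).
Local Notation Rv := (sysR S).
Local Notation U1 := (svdU1 s).
Local Notation U2 := (svdU2 s).
Local Notation Sg := (svdS s).
Local Notation pH k := (\rank (sysH S k)).

Definition T1 k : 'M[R]_(pH k, l) :=
  (U1 k)^T
  - (U1 k)^T *m Rv k *m U2 k *m invmx ((U2 k)^T *m Rv k *m U2 k) *m (U2 k)^T.
Definition T2 k : 'M[R]_(l - pH k, l) := (U2 k)^T.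
Definition C1 k := T1 k *m C k.
Definition C2 k := T2 k *m C k.
Definition D1 k := T1 k *m D k.
Definition D2 k := T2 k *m D k.
Definition R1 k := T1 k *m Rv k *m (T1 k)^T.
Definition R2 k := T2 k *m Rv k *m (T2 k)^T.
Definition G1 k := sysG S k *m svdV1 s k.
Definition G2 k := sysG S k *m svdV2 s k.

(* M2gain k is M_{2,k+1} (it produces the estimate of d_{2,k});
   Lgain k is L_k, and Lgain 0 is never used. *)
Record gains := Gains {
  M1gain : forall k, 'M[R]_(pH k);
  M2gain : forall k, 'M[R]_(p - pH k, l - pH k.+1);
  Lgain  : nat -> 'M[R]_(n, l) }.

Inductive algorithm := ULISE | PLISE.

Section Filter.
Variables (a : algorithm) (g : gains) (xhat0 : 'cV[R]_n).
Variables (u : nat -> 'cV[R]_m) (y : nat -> 'cV[R]_l).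

Definition residual1 k (x : 'cV[R]_n) : 'cV[R]_(pH k) :=
  T1 k *m y k - C1 k *m x - D1 k *m u k.
Definition residual2 k (x : 'cV[R]_n) : 'cV[R]_(l - pH k) :=
  T2 k *m y k - C2 k *m x - D2 k *m u k.
Definition innovation k (x : 'cV[R]_n) : 'cV[R]_l :=
  y k - C k *m x - D k *m u k.

(* e = (xstar_{k|k}, xhat_{k|k}) *)
Definition d1_residual k (e : 'cV[R]_n * 'cV[R]_n) : 'cV[R]_(pH k) :=
  residual1 k (match a with ULISE => e.2 | PLISE => e.1 end).
Definition predict k (e : 'cV[R]_n * 'cV[R]_n) : 'cV[R]_n :=
  A k *m e.2 + B k *m u k + G1 k *m (M1gain g k *m d1_residual k e).

Fixpoint estimate k : 'cV[R]_n * 'cV[R]_n :=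
  if k is k'.+1 then
    let xp := predict k' (estimate k') in
    let xs := xp + G2 k' *m (M2gain g k' *m residual2 k'.+1 xp) in
    (xs, xs + Lgain g k'.+1 *m innovation k'.+1 xs)
  else (xhat0, xhat0).

Definition xstar k := (estimate k).1.
Definition xhat k := (estimate k).2.
Definition r1 k := d1_residual k (estimate k).
(* the residual at time k+1 from which d_{2,k} is estimated *)
Definition r2 k := residual2 k.+1 (predict k (estimate k)).
Definition d1hat k := M1gain g k *m r1 k.
Definition d2hat k := M2gain g k *m r2 k.
Definition dhat k := svdV1 s k *m d1hat k + svdV2 s k *m d2hat k.
Definition innov k := innovation k (xstar k).

End Filter.

(* In the definitions indexed by k below, the inputs are the quantities at time
   k and the result is the gain or covariance at time k+1. *)

Definition M1 k := invmx (Sg k).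
Definition Ahat k := A k - G1 k *m M1 k *m C1 k.
Definition Qhat k := G1 k *m M1 k *m R1 k *m (M1 k)^T *m (G1 k)^T + Q k.

Section Gains.
Variables (k : nat) (Pt Ps : 'M[R]_n).

Definition Rtilde2 := C2 k.+1 *m Pt *m (C2 k.+1)^T + R2 k.+1.
Definition Pd2 : 'M[R]_(p - pH k) :=
  invmx ((G2 k)^T *m (C2 k.+1)^T *m invmx Rtilde2 *m C2 k.+1 *m G2 k).
Definition M2 : 'M[R]_(p - pH k, l - pH k.+1) :=
  Pd2 *m (G2 k)^T *m (C2 k.+1)^T *m invmx Rtilde2.
Definition GMUR : 'M[R]_(n, l) := G2 k *m M2 *m (U2 k.+1)^T *m Rv k.+1.
Definition Rstar : 'M[R]_l :=
  C k.+1 *m Ps *m (C k.+1)^T + Rv k.+1 - C k.+1 *m GMUR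
  - Rv k.+1 *m U2 k.+1 *m M2^T *m (G2 k)^T *m (C k.+1)^T.
Definition Kgain : 'M[R]_(n, l) := Ps *m (C k.+1)^T - GMUR.
Definition M1star : 'M[R]_(pH k.+1, l) :=
  invmx (Sg k.+1)
  *m invmx ((U1 k.+1)^T *m mpinv Rstar *m U1 k.+1)
  *m (U1 k.+1)^T *m mpinv Rstar.
Definition L : 'M[R]_(n, l) :=
  Kgain *m (1%:M - U1 k.+1 *m Sg k.+1 *m M1star)^T *m mpinv Rstar.
Definition Pxnext : 'M[R]_n :=
  let J := 1%:M - L *m C k.+1 in
  J *m Ps *m J^T + L *m Rv k.+1 *m L^T + J *m GMUR *m L^T
  + L *m Rv k.+1 *m U2 k.+1 *m M2^T *m (G2 k)^T *m J^T.

End Gains.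

Variable P0 : 'M[R]_n.

Definition ulise_Pt k (Px : 'M[R]_n) : 'M[R]_n :=
  Ahat k *m Px *m (Ahat k)^T + Qhat k.
Definition ulise_Ps k (Px : 'M[R]_n) : 'M[R]_n :=
  let N := M2 k (ulise_Pt k Px) in
  let J := 1%:M - G2 k *m N *m C2 k.+1 in
  G2 k *m N *m R2 k.+1 *m N^T *m (G2 k)^T + J *m ulise_Pt k Px *m J^T.

Fixpoint ulise_Px k : 'M[R]_n :=
  if k is k'.+1 then
    Pxnext k' (ulise_Pt k' (ulise_Px k')) (ulise_Ps k' (ulise_Px k'))
  else P0.

Definition ulise_gains : gains := {|
  M1gain := M1;
  M2gain := fun k => M2 k (ulise_Pt k (ulise_Px k));
  Lgain := fun k => if k is k'.+1 then
             L k' (ulise_Pt k' (ulise_Px k')) (ulise_Ps k' (ulise_Px k'))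
           else 0 |}.

Record plise_cov k := PliseCov {
  covx : 'M[R]_n;
  covxs : 'M[R]_n;
  covxd1 : 'M[R]_(n, pH k) }.

Section PliseStep.
Variables (k : nat) (c : plise_cov k).

Definition plise_Pd1 : 'M[R]_(pH k) :=
  M1 k *m (C1 k *m covxs c *m (C1 k)^T + R1 k) *m M1 k.

(* Error covariance of the one-step prediction (its d_{2,k}-term left out).
   In ULISE, where d_{1,k} is estimated from xhat_{k|k}, it equals
   Ahat k *m Px *m (Ahat k)^T + Qhat k.  In PLISE, d_{1,k} is estimated from
   xstar_{k|k}, the prediction error is A x~ + G1 d1~ + w, and that shorter
   expression is not its covariance (except at k = 0 and in degenerate
   cases): using it here would make M2 suboptimal. *)
Definition plise_Pt : 'M[R]_n :=
  row_mx (A k) (G1 k)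
  *m block_mx (covx c) (covxd1 c) (covxd1 c)^T plise_Pd1
  *m (row_mx (A k) (G1 k))^T
  + Q k.

Definition plise_M2 := M2 k plise_Pt.
Definition plise_Pxd2 : 'M[R]_(n, p - pH k) :=
  - (covx c *m (A k)^T *m (C2 k.+1)^T *m plise_M2^T)
  - covxd1 c *m (G1 k)^T *m (C2 k.+1)^T *m plise_M2^T.
Definition plise_Pd12 : 'M[R]_(pH k, p - pH k) :=
  - ((covxd1 c)^T *m (A k)^T *m (C2 k.+1)^T *m plise_M2^T)
  - plise_Pd1 *m (G1 k)^T *m (C2 k.+1)^T *m plise_M2^T.
Definition plise_Ps : 'M[R]_n :=
  let AG := row_mx (A k) (row_mx (G1 k) (G2 k)) in
  AG
  *m block_mx (covx c) (row_mx (covxd1 c) plise_Pxd2)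
       (col_mx (covxd1 c)^T plise_Pxd2^T)
       (block_mx plise_Pd1 plise_Pd12 plise_Pd12^T (Pd2 k plise_Pt))
  *m AG^T
  + Q k - G2 k *m plise_M2 *m C2 k.+1 *m Q k
  - Q k *m (C2 k.+1)^T *m plise_M2^T *m (G2 k)^T.
Definition plise_L : 'M[R]_(n, l) := L k plise_Pt plise_Ps.
Definition plise_step : plise_cov k.+1 := {|
  covx := Pxnext k plise_Pt plise_Ps;
  covxs := plise_Ps;
  covxd1 :=
    - ((1%:M - plise_L *m C k.+1) *m plise_Ps *m (C1 k.+1)^T *m (M1 k.+1)^T)
    - plise_L *m Rv k.+1 *m (T2 k.+1)^T *m plise_M2^T *m (G2 k)^T
      *m (C1 k.+1)^T *m (M1 k.+1)^T |}.

End PliseStep.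

Fixpoint plise_covs k : plise_cov k :=
  match k with
  | 0 => PliseCov P0 P0 (- (P0 *m (C1 0)^T *m invmx (Sg 0)))
  | k'.+1 => plise_step (plise_covs k')
  end.

Definition plise_gains : gains := {|
  M1gain := M1;
  M2gain := fun k => plise_M2 (plise_covs k);
  Lgain := fun k => if k is k'.+1 then plise_L (plise_covs k') else 0 |}.

Definition algorithm_gains (a : algorithm) : gains :=
  match a with ULISE => ulise_gains | PLISE => plise_gains end.

End System.

Section Optimality.
Context {dsp : measure_display} {T : measurableType dsp} {R : realType}.
Variable P : probability T R.
Context {n m p l : nat}.

(* The unknown input is an arbitrary process: deterministic, random, possibly
   depending on the noise and on the initial state. *)
Definition unknown_input (d : nat -> T -> 'cV[R]_p) : Prop :=
  forall k, measurable_vec (d k).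

(* W is the gain of the estimate b + W r of x among all estimates b + W' r. *)
Definition unbiased_gain q r
    (x b : (nat -> T -> 'cV[R]_p) -> T -> 'cV[R]_q)
    (res : (nat -> T -> 'cV[R]_p) -> T -> 'cV[R]_r)
    (W : 'M[R]_(q, r)) : Prop :=
  forall d, unknown_input d ->
    zero_mean P (fun t => x d t - (b d t + W *m res d t)).

Definition BLUE_gain q r
    (x : (nat -> T -> 'cV[R]_p) -> T -> 'cV[R]_q)
    (res : (nat -> T -> 'cV[R]_p) -> T -> 'cV[R]_r)
    (W : 'M[R]_(q, r)) : Prop :=
  unbiased_gain x (fun _ _ => 0) res W /\
  forall W', unbiased_gain x (fun _ _ => 0) res W' ->
    forall d, unknown_input d ->
      (mse P (fun t => x d t - W *m res d t)%R
       <= mse P (fun t => x d t - W' *m res d t)%R)%E.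

Definition MVU_gain q r
    (x b : (nat -> T -> 'cV[R]_p) -> T -> 'cV[R]_q)
    (res : (nat -> T -> 'cV[R]_p) -> T -> 'cV[R]_r)
    (W : 'M[R]_(q, r)) : Prop :=
  unbiased_gain x b res W /\
  forall W', unbiased_gain x b res W' ->
    forall d, unknown_input d ->
      (trace_cov P (fun t => x d t - (b d t + W *m res d t))%R
       <= trace_cov P (fun t => x d t - (b d t + W' *m res d t))%R)%E.

Variables (S : @system R n m p l) (u : nat -> 'cV[R]_m).
Variables (x0 : T -> 'cV[R]_n) (w : nat -> T -> 'cV[R]_n)
  (v : nat -> T -> 'cV[R]_l).

Fixpoint state (d : nat -> T -> 'cV[R]_p) k (t : T) : 'cV[R]_n :=
  if k is k'.+1 then
    sysA S k' *m state d k' t + sysB S k' *m u k' + sysG S k' *m d k' t + w k' t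
  else x0 t.

Definition output (d : nat -> T -> 'cV[R]_p) (t : T) k : 'cV[R]_l :=
  sysC S k *m state d k t + sysD S k *m u k + sysH S k *m d k t + v k t.

Variables (s : svd_factors (sysH S)) (xhat0 : 'cV[R]_n).

Definition optimal_filter (a : algorithm) (g : gains S) : Prop :=
  [/\ forall k d, unknown_input d ->
        zero_mean P (fun t => state d k t - xhat s a g xhat0 u (output d t) k),
      forall k d, unknown_input d ->
        zero_mean P (fun t => d k t - dhat s a g xhat0 u (output d t) k),
      forall k, BLUE_gain (fun d t => (svdV1 s k)^T *m d k t)
        (fun d t => r1 s a g xhat0 u (output d t) k) (M1gain g k),
      forall k, BLUE_gain (fun d t => (svdV2 s k)^T *m d k t)
        (fun d t => r2 s a g xhat0 u (output d t) k) (M2gain g k)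
    & forall k, MVU_gain (fun d t => state d k.+1 t)
        (fun d t => xstar s a g xhat0 u (output d t) k.+1)
        (fun d t => innov s a g xhat0 u (output d t) k.+1) (Lgain g k.+1)].

Definition system_assumptions : Prop :=
  [/\ [/\ (1 <= l)%N, (l <= n)%N & (p <= l)%N],
      (forall k, (\rank (row_mx (sysG S k)^T (sysH S k)^T) <= p)%N) /\
      (exists k, \rank (row_mx (sysG S k)^T (sysH S k)^T) = p),
      [/\ bounded_mxseq (sysA S), bounded_mxseq (sysB S) &
          bounded_mxseq (sysG S)] /\
      [/\ bounded_mxseq (sysC S), bounded_mxseq (sysD S) &
          bounded_mxseq (sysH S)],
      forall k, psdmx (sysQ S k)
    & forall k, pdmx (sysR S k)].

Definition noise_assumptions : Prop :=
  [/\ forall k, L2_vec P (w k) /\ L2_vec P (v k),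
      forall k, zero_mean P (w k) /\ zero_mean P (v k),
      forall j k, has_cov P (w j) (w k) (if j == k then sysQ S k else 0) /\
                  has_cov P (v j) (v k) (if j == k then sysR S k else 0),
      forall j k, has_cov P (w j) (v k) 0
    & forall k, independent_vec P x0 (w k) /\ independent_vec P x0 (v k)].

End Optimality.

(* Main.v *)
Require Import Defs.
From HB Require Import structures.
From mathcomp Require Import all_boot all_order all_algebra.
From mathcomp Require Import all_classical all_reals all_analysis.
From mathcomp Require Import measurable_realfun lebesgue_integral_fubini.
From mathcomp Require Import ring.
Set Implicit Arguments.
Unset Strict Implicit.
Unset Printing Implicit Defensive.
Import Order.TTheory GRing.Theory Num.Theory.
Import numFieldNormedType.Exports.
Local Open Scope classical_set_scope.
Local Open Scope ring_scope.

(** Subtract the filter from the system: every estimation error is an affine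
    function of the unknown input, with a random part that depends only on the
    initial error and on the noises. The input disappears from the errors as
    soon as the gains satisfy M1 Sigma = 1, M2 (C2 G2) = 1 and L U1 = 0 (that
    is, L H = 0), and conversely a gain is unbiased for all inputs only if it
    satisfies the corresponding identity ([zero_mean_affine]). So the theorem
    splits in two: the errors are centered, and each gain minimizes the trace
    of an error covariance under a linear constraint.

    Errors are vectors with entries in the space [cvar] of centered
    square-integrable variables, in which a cross-covariance [Cov] is a matrix of
    inner products and matrices act linearly ([act]). A constrained gain is
    optimal when its error is uncorrelated with all admissible corrections
    ([orthogonality_principle]). For d_1 the constraint leaves one gain. For d_2
    this is the Gauss-Markov theorem for the residual covariance Rtilde2, which
    is positive definite; the rank hypothesis says that C2 G2 has full column
    rank ([M2_unbiased], [M2_optimal]). For the state, the innovation covariance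
    Rstar may be singular, because the estimate of d_2 has already used
    a part of the measurement. Still, the component T1 v of the innovation
    is nondegenerate and uncorrelated with the other ones, so that U1 is
    orthogonal to the null space of Rstar ([Rstar_null_U1]). Hence
    U1^T Rstar^+ U1 is invertible, L U1 = 0, and the Lagrange condition holds
    ([constrained_gain_normal], [L_unbiased], [L_optimal]).

    All this supposes that the matrices Ptilde and Pstar computed by
    the algorithms are the covariances of the actual errors, which is proved by
    induction on time ([tracksP]). The induction uses that the errors at time k
    are uncorrelated with later noises ([err_future]), that x_0 is
    uncorrelated with the noises by independence ([expectation_mul_indep]), and
    that T1 v_k is uncorrelated with the errors at time k ([Cov_e_T1v],
    [Cov_es_T1v]), a consequence of T1 R U2 = 0 and L U1 = 0. In ULISE this last
    fact gives the covariance of A e - G1 M1 (C1 e + T1 v) + w at once; in PLISE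
    d_1 is estimated from xstar and the joint covariance of the errors is
    propagated instead. *)

(** * Expectation of a product of independent variables *)

Section Independence.
Context {d : measure_display} {T : measurableType d} {R : realType}.
Variable P : probability T R.

Lemma Lfun2_Lfun1 (f : T -> R) : f \in Lfun P 2%:E -> f \in Lfun P 1.
Proof. by apply: Lfun_subset12; rewrite fin_num_measure. Qed.

Lemma Lfun_measurable p (f : T -> R) : f \in Lfun P p -> measurable_fun setT f.
Proof. by move=> /sub_Lfun_mfun /[!inE]. Qed.

(** Independence says that the joint law of X and Y and the product of
    their laws agree on rectangles, hence are the same measure; the integral
    of f (X, Y) is then an iterated integral by Fubini's theorem. *)
Lemma Fubini_indep d1 d2 (T1 : measurableType d1) (T2 : measurableType d2)
    (X : {mfun T >-> T1}) (Y : {mfun T >-> T2}) (f : T1 * T2 -> \bar R) :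
  (forall A B, measurable A -> measurable B ->
     P (X @^-1` A `&` Y @^-1` B) = (P (X @^-1` A) * P (Y @^-1` B))%E) ->
  measurable_fun setT f ->
  P.-integrable setT (fun t => f (X t, Y t)) ->
  (\int[P]_t f (X t, Y t) =
   \int[distribution P X]_x \int[distribution P Y]_y f (x, y))%E.
Proof.
move=> indep mf iXY.
pose Z t := (X t, Y t).
have mZ : measurable_fun setT Z by exact: measurable_fun_pair.
pose Z' : {mfun T >-> (T1 * T2)%type} :=
  HB.pack Z (isMeasurableFun.Build _ _ _ _ Z mZ).
have pushE z : measurable z ->
    (distribution P X \x distribution P Y)%E z = pushforward P Z' z.
  move=> mz; apply: product_measure_unique mz => A B mA mB.
  by rewrite /distribution/= /pushforward -indep.
have iZ : (pushforward P Z').-integrable setT f by exact: integrable_pushforward.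
rewrite (_ : (\int[P]_t _ = \int[pushforward P Z']_z f z)%E); last first.
  by rewrite integral_pushforward.
rewrite [LHS](eq_measure_integral (distribution P X \x distribution P Y)%E);
  last first.
  by move=> A mA _; symmetry; exact: pushE.
rewrite -[LHS]integral12_prod_meas1 //.
have [_ Zoo] := integrableP _ _ _ iZ.
apply/integrableP; split => //; move: Zoo.
rewrite (eq_measure_integral (distribution P X \x distribution P Y)%E) //.
by move=> A mA _; symmetry; exact: pushE.
Qed.

Lemma expectation_mul_indep (X Y : T -> R) :
  X \in Lfun P 2%:E -> Y \in Lfun P 2%:E ->
  (forall A B : set R, measurable A -> measurable B ->
     P (X @^-1` A `&` Y @^-1` B) = (P (X @^-1` A) * P (Y @^-1` B))%E) ->
  ('E_P[X * Y] = 'E_P[X] * 'E_P[Y])%E.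
Proof.
move=> X2 Y2 indep.
have mX := Lfun_measurable X2; have mY := Lfun_measurable Y2.
have iX := (Lfun1_integrable P X).1 (Lfun2_Lfun1 X2).
have iY := (Lfun1_integrable P Y).1 (Lfun2_Lfun1 Y2).
have iXY := (Lfun1_integrable P (X \* Y)).1 (Lfun2_mul_Lfun1 X2 Y2).
pose X' : {mfun T >-> R} := HB.pack X (isMeasurableFun.Build _ _ _ _ X mX).
pose Y' : {mfun T >-> R} := HB.pack Y (isMeasurableFun.Build _ _ _ _ Y mY).
have mE : measurable_fun [set: R] (EFin : R -> \bar R) by [].
have iYE : (distribution P Y').-integrable setT EFin.
  by apply: integrable_pushforward.
have EYE : (\int[distribution P Y']_y y%:E = 'E_P[Y])%E.
  by rewrite unlock integral_pushforward.
have iXE : (distribution P X').-integrable setT EFin.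
  by apply: integrable_pushforward.
have EXE : (\int[distribution P X']_y y%:E = 'E_P[X])%E.
  by rewrite unlock integral_pushforward.
transitivity (\int[P]_t ((X' t, Y' t).1 * (X' t, Y' t).2)%:E)%E.
  by rewrite unlock.
rewrite (@Fubini_indep _ _ _ _ X' Y' (fun z => (z.1 * z.2)%:E)) //; last first.
  by apply/measurable_EFinP; exact: measurable_funM.
rewrite -EXE -EYE /=.
under eq_integral => x _.
  under eq_integral => y _ do rewrite EFinM.
  rewrite integralZl //.
  over.
have /fineK <- : (\int[distribution P Y']_y y%:E)%E \is a fin_num.
  by rewrite EYE expectation_fin_num // Lfun2_Lfun1.
by rewrite integralZr.
Qed.
End Independence.

(** * The space of centered square-integrable variables *)

Section Centered.
Context {d : measure_display} {T : measurableType d} {R : realType}.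
Variable P : probability T R.

Definition centered : {pred T -> R} :=
  [pred f | (f \in Lfun P 2%:E) && `[< ('E_P[f] = 0)%E >]].

Lemma centered_submod_closed : submod_closed centered.
Proof.
have le12 : (1 <= 2%:E :> \bar R)%E by rewrite lee1n.
have sub := Lfun_submod_closed P le12.
split=> [|a f g /andP[f2 /asboolP f0] /andP[g2 /asboolP g0]].
  by apply/andP; split; [exact: sub.1|apply/asboolP; exact: expectation_cst].
have ag2 : a *: f \in Lfun P 2%:E by have := sub.2 a f 0 f2 sub.1; rewrite addr0.
apply/andP; split; first exact: sub.2.
apply/asboolP.
rewrite expectationD ?Lfun2_Lfun1//.
have -> : a *: f = a \o* f by apply/funext => t; rewrite /= mulrC.
by rewrite expectationZl ?Lfun2_Lfun1// f0 g0 mule0 adde0.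
Qed.

HB.instance Definition _ :=
  GRing.isSubmodClosed.Build R (T -> R) centered centered_submod_closed.

(** All estimation errors of the filter live in this space, on which the
    covariance is a genuine symmetric positive bilinear form: no
    integrability condition has to be carried along afterwards. *)
Record cvar := CVar { cval :> T -> R; cvarP : cval \in centered }.

HB.instance Definition _ := [isSub for cval].
HB.instance Definition _ := [Choice of cvar by <:].
HB.instance Definition _ := [SubChoice_isSubLmodule of cvar by <:].

Lemma cvar_L2 (f : cvar) : (f : T -> R) \in Lfun P 2%:E.
Proof. by case: f => f /= /andP[]. Qed.

Lemma cvar_E (f : cvar) : ('E_P[f] = 0)%E.
Proof. by case: f => f /= /andP[_ /asboolP]. Qed.

(** On centered variables the L2 inner product is the covariance. *)
Definition ip (f g : cvar) : R := fine ('E_P[(f : T -> R) * (g : T -> R)])%E.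

Lemma ip_EFin (f g : cvar) : (ip f g)%:E = ('E_P[(f : T -> R) * (g : T -> R)])%E.
Proof. by rewrite /ip fineK// expectation_fin_num// Lfun2_mul_Lfun1 ?cvar_L2. Qed.

Lemma ip_covariance (f g : cvar) : (ip f g)%:E = covariance P f g.
Proof.
by rewrite covarianceE ?cvar_E ?mule0 ?sube0 ?ip_EFin ?Lfun2_mul_Lfun1
  ?Lfun2_Lfun1 ?cvar_L2.
Qed.

Lemma ipC f g : ip f g = ip g f.
Proof. by rewrite /ip mulrC. Qed.

Lemma ip_linear f : linear_for *%R (ip ^~ f).
Proof.
move=> a g h; apply: EFin_inj; rewrite EFinD EFinM !ip_EFin.
have gf1 : (g : T -> R) * (f : T -> R) \in Lfun P 1.
  by apply: Lfun2_mul_Lfun1; exact: cvar_L2.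
have hf1 : (h : T -> R) * (f : T -> R) \in Lfun P 1.
  by apply: Lfun2_mul_Lfun1; exact: cvar_L2.
have agf1 : a \o* ((g : T -> R) * (f : T -> R)) \in Lfun P 1 by exact: Lfun_scale.
rewrite [X in ('E_P[X])%E](_ : _ =
    (a \o* ((g : T -> R) * (f : T -> R)) + (h : T -> R) * (f : T -> R))); last first.
  apply/funext => t; change ((a * g t + h t) * f t = g t * f t * a + h t * f t).
  by rewrite mulrDl -mulrA mulrC.
by rewrite expectationD ?expectationZl.
Qed.

Lemma ip_ge0 f : 0 <= ip f f.
Proof.
rewrite -lee_fin ip_EFin; apply: expectation_ge0 => t.
by rewrite /= -expr2 sqr_ge0.
Qed.
End Centered.

(** * Random vectors and their cross-covariances *)

Section RandomVectors.
Context {d : measure_display} {T : measurableType d} {R : realType}.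
Variable P : probability T R.
Local Notation V := (cvar P).

Definition act q r (A : 'M[R]_(q, r)) (X : 'cV[V]_r) : 'cV[V]_q :=
  \col_i \sum_j A i j *: X j 0.
Local Notation "A ** X" := (act A X) (at level 40, left associativity).

Lemma act_mulmx q r s (A : 'M[R]_(q, r)) (B : 'M[R]_(r, s)) X :
  (A *m B) ** X = A ** (B ** X).
Proof.
apply/colP => i; rewrite !mxE.
under eq_bigr => k _ do rewrite mxE scaler_suml.
rewrite exchange_big /=; apply: eq_bigr => k _.
by rewrite mxE scaler_sumr; apply: eq_bigr => j _; rewrite scalerA.
Qed.

Lemma actDl q r (A B : 'M[R]_(q, r)) X : (A + B) ** X = A ** X + B ** X.
Proof.
apply/colP => i; rewrite !mxE -big_split/=.
by apply: eq_bigr => k _; rewrite mxE scalerDl.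
Qed.

Lemma actNl q r (A : 'M[R]_(q, r)) X : (- A) ** X = - (A ** X).
Proof.
by apply/colP => i; rewrite !mxE -sumrN; apply: eq_bigr => k _; rewrite mxE scaleNr.
Qed.

Lemma actBl q r (A B : 'M[R]_(q, r)) X : (A - B) ** X = A ** X - B ** X.
Proof. by rewrite actDl actNl. Qed.

Lemma actDr q r (A : 'M[R]_(q, r)) X Y : A ** (X + Y) = A ** X + A ** Y.
Proof.
apply/colP => i; rewrite !mxE -big_split/=.
by apply: eq_bigr => k _; rewrite mxE scalerDr.
Qed.

Lemma actNr q r (A : 'M[R]_(q, r)) X : A ** (- X) = - (A ** X).
Proof.
by apply/colP => i; rewrite !mxE -sumrN; apply: eq_bigr => k _; rewrite mxE scalerN.
Qed.

Lemma act1 q (X : 'cV[V]_q) : 1%:M ** X = X.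
Proof.
apply/colP => i; rewrite !mxE (bigD1 i)//= mxE eqxx scale1r big1 ?addr0//.
by move=> j /negPf ji; rewrite mxE eq_sym ji scale0r.
Qed.

Lemma act_row_col q r s (A : 'M[R]_(q, r)) (B : 'M[R]_(q, s)) X Y :
  row_mx A B ** col_mx X Y = A ** X + B ** Y.
Proof.
apply/colP => i; rewrite !mxE big_split_ord/=; congr (_ + _).
  by apply: eq_bigr => j _; rewrite row_mxEl col_mxEu.
by apply: eq_bigr => j _; rewrite row_mxEr col_mxEd.
Qed.

Definition Cov q r (X : 'cV[V]_q) (Y : 'cV[V]_r) : 'M[R]_(q, r) :=
  \matrix_(i, j) ip (X i 0) (Y j 0).

Lemma CovC q r (X : 'cV[V]_q) (Y : 'cV[V]_r) : (Cov X Y)^T = Cov Y X.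
Proof. by apply/matrixP => i j; rewrite !mxE ipC. Qed.

Lemma ipDl (f g h : V) : ip (f + g) h = ip f h + ip g h.
Proof. by have := ip_linear h 1 f g; rewrite /= scale1r mul1r. Qed.

Lemma ip0l (h : V) : ip 0 h = 0.
Proof. by apply: (addrI (ip 0 h)); rewrite -ipDl !addr0. Qed.

Lemma ipZl a (f h : V) : ip (a *: f) h = a * ip f h.
Proof. by have := ip_linear h a f 0; rewrite /= addr0 ip0l addr0. Qed.

Lemma ip_suml r (F : 'I_r -> V) h : ip (\sum_i F i) h = \sum_i ip (F i) h.
Proof.
elim/big_ind2: _ => // [|x1 x2 y1 y2 <- <-]; first exact: ip0l.
by rewrite ipDl.
Qed.

Lemma CovMl q r s (A : 'M[R]_(q, r)) X (Y : 'cV[V]_s) :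
  Cov (A ** X) Y = A *m Cov X Y.
Proof.
apply/matrixP => i j; rewrite !mxE ip_suml; apply: eq_bigr => k _.
by rewrite ipZl mxE.
Qed.

Lemma CovMr q r s (A : 'M[R]_(q, r)) X (Y : 'cV[V]_s) :
  Cov Y (A ** X) = Cov Y X *m A^T.
Proof. by rewrite -CovC CovMl trmx_mul CovC. Qed.

Lemma CovDl q r X1 X2 (Y : 'cV[V]_r) :
  Cov (X1 + X2 : 'cV_q) Y = Cov X1 Y + Cov X2 Y.
Proof. by apply/matrixP => i j; rewrite !mxE ipDl. Qed.

Lemma CovNl q r X (Y : 'cV[V]_r) : Cov (- X : 'cV_q) Y = - Cov X Y.
Proof. by apply/matrixP => i j; rewrite !mxE -scaleN1r ipZl mulN1r. Qed.

Lemma CovBl q r X1 X2 (Y : 'cV[V]_r) :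
  Cov (X1 - X2 : 'cV_q) Y = Cov X1 Y - Cov X2 Y.
Proof. by rewrite CovDl CovNl. Qed.

Lemma CovDr q r X1 X2 (Y : 'cV[V]_r) :
  Cov Y (X1 + X2 : 'cV_q) = Cov Y X1 + Cov Y X2.
Proof. by rewrite -CovC CovDl linearD/= !CovC. Qed.

Lemma CovNr q r X (Y : 'cV[V]_r) : Cov Y (- X : 'cV_q) = - Cov Y X.
Proof. by rewrite -CovC CovNl linearN/= !CovC. Qed.

Lemma CovBr q r X1 X2 (Y : 'cV[V]_r) :
  Cov Y (X1 - X2 : 'cV_q) = Cov Y X1 - Cov Y X2.
Proof. by rewrite CovDr CovNr. Qed.

Lemma Cov_colr q r s (X : 'cV[V]_q) (Y : 'cV[V]_r) (Z : 'cV[V]_s) :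
  Cov X (col_mx Y Z) = row_mx (Cov X Y) (Cov X Z).
Proof.
apply/matrixP => i j; rewrite !mxE.
by case: splitP => k jk; rewrite !mxE; congr ip; apply: ord_inj.
Qed.

Lemma Cov_coll q r s (X : 'cV[V]_q) (Y : 'cV[V]_r) (Z : 'cV[V]_s) :
  Cov (col_mx Y Z) X = col_mx (Cov Y X) (Cov Z X).
Proof. by rewrite -CovC Cov_colr tr_row_mx !CovC. Qed.

Lemma Cov_sum_sqr q (X : 'cV[V]_q) : \tr (Cov X X) = \sum_i ip (X i 0) (X i 0).
Proof. by apply: eq_bigr => i _; rewrite mxE. Qed.

Lemma tr_Cov_ge0 q (X : 'cV[V]_q) : 0 <= \tr (Cov X X).
Proof. by rewrite Cov_sum_sqr sumr_ge0// => i _; exact: ip_ge0. Qed.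

(** The Cauchy-Schwarz inequality in the degenerate case: the affine
    function t |-> ip (t f + g) (t f + g) is nonnegative, hence constant. *)
Lemma ip_null (f g : V) : ip f f = 0 -> ip f g = 0.
Proof.
move=> f0; apply/eqP; apply: contraT => fg0.
(* at this t the affine function takes the value -1 *)
pose t := - (ip g g + 1) / (ip f g *+ 2).
have := ip_ge0 (t *: f + g).
rewrite ipDl ipZl [ip f _]ipC [ip g _]ipC !ipDl !ipZl f0 mulr0 add0r [ip g f]ipC.
rewrite addrA -mulr2n -mulrnAr /t divfK ?mulrn_eq0//.
by rewrite opprD addrAC addNr add0r oppr_ge0 ler10.
Qed.

Lemma Cov_null q r (X : 'cV[V]_q) (Y : 'cV[V]_r) : Cov X X = 0 -> Cov X Y = 0.
Proof.
move=> X0; apply/matrixP => i j; rewrite !mxE; apply: ip_null.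
by have /matrixP/(_ i i) := X0; rewrite !mxE.
Qed.

(** The components of X along z have zero variance, so nothing is
    correlated with them. This is how a singular innovation covariance is
    handled. *)
Lemma Cov_ker q r s (X : 'cV[V]_q) (Y : 'cV[V]_r) (z : 'M[R]_(q, s)) :
  z^T *m Cov X X *m z = 0 -> Cov Y X *m z = 0.
Proof.
move=> z0; have : Cov (z^T ** X) (z^T ** X) = 0 by rewrite CovMl CovMr trmxK mulmxA.
move=> /(@Cov_null _ _ _ Y) /(congr1 trmx); rewrite CovC CovMr trmxK => ->.
by rewrite trmx0.
Qed.

Lemma Cov_uncorrelatedD q (X Y : 'cV[V]_q) :
  Cov X Y = 0 -> Cov (X + Y) (X + Y) = Cov X X + Cov Y Y.
Proof.
move=> XY; have YX : Cov Y X = 0 by rewrite -CovC XY trmx0.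
by rewrite CovDl !CovDr XY YX addr0 add0r.
Qed.

(** An error Y that is uncorrelated with the admissible corrections W Z is
    the smallest one (Pythagoras): both optimality claims of the theorem are
    instances. *)
Lemma orthogonality_principle q r (Y : 'cV[V]_q) (Z : 'cV[V]_r) (W : 'M[R]_(q, r)) :
  Cov Y Z *m W^T = 0 ->
  \tr (Cov Y Y) <= \tr (Cov (Y - W ** Z) (Y - W ** Z)).
Proof.
move=> YZ; have YWZ : Cov Y (W ** Z) = 0 by rewrite CovMr.
rewrite CovBl !CovBr -[Cov (W ** Z) Y]CovC !YWZ trmx0 subr0 sub0r opprK linearD/=.
by rewrite lerDl tr_Cov_ge0.
Qed.

Definition ev q (X : 'cV[V]_q) (t : T) : 'cV[R]_q := \col_i (X i 0 : T -> R) t.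

Lemma evD q (X Y : 'cV[V]_q) t : ev (X + Y) t = ev X t + ev Y t.
Proof. by apply/colP => i; rewrite !mxE. Qed.

Lemma evN q (X : 'cV[V]_q) t : ev (- X) t = - ev X t.
Proof. by apply/colP => i; rewrite !mxE. Qed.

Lemma evB q (X Y : 'cV[V]_q) t : ev (X - Y) t = ev X t - ev Y t.
Proof. by rewrite evD evN. Qed.

Lemma cvar_sum_apply r (F : 'I_r -> V) t :
  (\sum_i F i : V) t = \sum_i F i t.
Proof. by elim/big_ind2: _ => // x1 x2 y1 y2 <- <-. Qed.

Lemma ev_act q r (A : 'M[R]_(q, r)) X t : ev (A ** X) t = A *m ev X t.
Proof.
apply/colP => i; rewrite !mxE cvar_sum_apply; apply: eq_bigr => j _.
by rewrite mxE.
Qed.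

Lemma ev_zero_mean q (X : 'cV[V]_q) : zero_mean P (ev X).
Proof.
move=> i; under eq_fun => t do rewrite mxE.
by split; [exact: Lfun2_Lfun1 (cvar_L2 _)|exact: cvar_E].
Qed.

Lemma ev_mse q (X : 'cV[V]_q) : mse P (ev X) = (\tr (Cov X X))%:E.
Proof.
rewrite Cov_sum_sqr -sumEFin; under eq_bigr => i _ do rewrite ip_EFin.
rewrite /mse unlock -integral_sum//; last first.
  move=> i; have Xi2 := cvar_L2 (X i 0).
  have /Lfun1_integrable := Lfun2_mul_Lfun1 Xi2 Xi2.
  by [].
apply: eq_integral => t _; rewrite !mxE sumEFin; congr EFin.
by apply: eq_bigr => i _; rewrite !mxE.
Qed.

Lemma ev_trace_cov q (X : 'cV[V]_q) : trace_cov P (ev X) = (\tr (Cov X X))%:E.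
Proof.
rewrite /trace_cov Cov_sum_sqr -sumEFin; apply: eq_bigr => i _.
rewrite ip_EFin; congr expectation; apply/funext => t.
by rewrite !mxE big_ord1 !mxE.
Qed.

Lemma has_cov_Cov q r (X : 'cV[V]_q) (Y : 'cV[V]_r) M :
  has_cov P (ev X) (ev Y) M -> Cov X Y = M.
Proof.
move=> XY; apply/matrixP => i j; apply: EFin_inj.
rewrite -XY mxE ip_covariance; congr covariance; apply/funext => t;
by rewrite mxE.
Qed.

Lemma ev_surj q (X : T -> 'cV[R]_q) : L2_vec P X -> zero_mean P X ->
  exists E : 'cV[V]_q, ev E = X.
Proof.
move=> X2 X0.
have Xc i : (fun t => X t i 0) \in centered P.
  by apply/andP; split; [exact: X2|apply/asboolP; exact: (X0 i).2].
by exists (\col_i CVar (Xc i)); apply/funext => t; apply/colP => i; rewrite !mxE.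
Qed.

Lemma Cov_psd q (X : 'cV[V]_q) : psdmx (Cov X X).
Proof.
split=> [|x]; first exact: CovC.
have := tr_Cov_ge0 (x^T ** X).
by rewrite CovMl CovMr trmxK mulmxA /mxtrace big_ord1.
Qed.

End RandomVectors.
Notation "A ** X" := (act A X) (at level 40, left associativity).

(** * Positive matrices and the Moore-Penrose inverse *)

Section PositiveMatrices.
Context {R : realType}.

Lemma kernel0_unitmx q (M : 'M[R]_q) :
  (forall x : 'cV[R]_q, M *m x = 0 -> x = 0) -> M \in unitmx.
Proof.
move=> ker0; rewrite -unitmx_tr -row_free_unit -kermx_eq0.
apply/eqP/row_matrixP => i; rewrite row0.
have /(congr1 trmx) : row i (kermx M^T) *m M^T = 0.
  by rewrite -row_mul mulmx_ker row0.
rewrite trmx_mul trmxK trmx0 => /ker0 /(congr1 trmx).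
by rewrite trmxK trmx0.
Qed.

Lemma pdmx_unit q (M : 'M[R]_q) : pdmx M -> M \in unitmx.
Proof.
move=> [_ Mpos]; apply: kernel0_unitmx => x Mx.
apply/eqP; apply: contraT => /Mpos.
by rewrite -mulmxA Mx mulmx0 mxE ltxx.
Qed.

Lemma pdmx_congr q r (M : 'M[R]_q) (A : 'M[R]_(r, q)) :
  pdmx M -> row_free A -> pdmx (A *m M *m A^T).
Proof.
move=> [Msym Mpos] Afree; split; first by rewrite !trmx_mul trmxK Msym mulmxA.
move=> x x0; have : A^T *m x != 0.
  apply: contra x0 => /eqP /(congr1 trmx); rewrite trmx_mul trmxK trmx0 => xA.
  rewrite -trmx_eq0; apply/eqP/(row_free_inj Afree).
  by rewrite xA mul0mx.
by move=> /Mpos; rewrite trmx_mul trmxK !mulmxA.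
Qed.

Lemma pdmx_add_psd q (M N : 'M[R]_q) : psdmx M -> pdmx N -> pdmx (M + N).
Proof.
move=> [Msym Mpos] [Nsym Npos]; split; first by rewrite linearD/= Msym Nsym.
by move=> x x0; rewrite mulmxDr mulmxDl mxE ltr_wpDl// Npos.
Qed.

Lemma pdmx_inv q (M : 'M[R]_q) : pdmx M -> pdmx (invmx M).
Proof.
move=> Mpd; have Mu := pdmx_unit Mpd.
have iMsym : (invmx M)^T = invmx M by rewrite trmx_inv Mpd.1.
have := @pdmx_congr _ _ M (invmx M) Mpd.
rewrite row_free_unit unitmx_inv => /(_ Mu).
by rewrite iMsym mulVmx// mul1mx.
Qed.

Lemma pdmx1 q : pdmx (1%:M : 'M[R]_q).
Proof.
split=> [|x x0]; first by rewrite trmx1.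
rewrite mulmx1 mxE lt_neqAle sumr_ge0 ?andbT; last first.
  by move=> i _; rewrite mxE -expr2 sqr_ge0.
apply: contra x0 => /eqP/esym x0; apply/eqP/colP => i; rewrite mxE; apply/eqP.
have sq_ge0 j : true -> 0 <= x^T 0 j * x j 0 by rewrite mxE -expr2 sqr_ge0.
have : x^T 0 i * x i 0 = 0 by apply: (psumr_eq0P sq_ge0 x0).
by move/eqP; rewrite mxE -expr2 sqrf_eq0.
Qed.

Lemma gram_unitmx q r (A : 'M[R]_(q, r)) : row_free A -> A *m A^T \in unitmx.
Proof.
by move=> Afree; rewrite -[A in A *m _]mulmx1; apply/pdmx_unit/pdmx_congr => //; exact: pdmx1.
Qed.

(** The pseudoinverse of a matrix is explicit from a rank factorization
    B C, since both Gram matrices are then invertible. *)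
Lemma penrose_full_rank q k r (B : 'M[R]_(q, k)) (C : 'M[R]_(k, r)) :
  row_free B^T -> row_free C ->
  penrose (B *m C) (C^T *m invmx (C *m C^T) *m invmx (B^T *m B) *m B^T).
Proof.
move=> /gram_unitmx; rewrite trmxK => uB /gram_unitmx uC.
set iC := invmx (C *m C^T); set iB := invmx (B^T *m B).
have iCK m (Y : 'M[R]_(m, _)) : Y *m C *m C^T *m iC = Y.
  by rewrite -!mulmxA (mulmxA C) mulmxV// mulmx1.
have iBK m (Y : 'M[R]_(m, _)) : Y *m iB *m B^T *m B = Y.
  by rewrite -!mulmxA mulVmx// mulmx1.
have iCsym : iC^T = iC by rewrite trmx_inv trmx_mul trmxK.
have iBsym : iB^T = iB by rewrite trmx_inv trmx_mul trmxK.
by split; rewrite !mulmxA ?iCK ?iBK ?trmx_mul ?trmxK ?iCsym ?iBsym ?mulmxA ?iCK ?iBK.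
Qed.

Lemma penrose_exists q r (M : 'M[R]_(q, r)) : exists X, penrose M X.
Proof.
have := @penrose_full_rank _ _ _ (col_base M) (row_base M).
rewrite mulmx_base row_base_free => penM.
eexists; apply: penM => //.
by rewrite /row_free mxrank_tr; exact: col_base_full.
Qed.

Lemma mpinvP q r (M : 'M[R]_(q, r)) : penrose M (mpinv M).
Proof. by rewrite /mpinv; case: xgetP => // /(_ _) H; have [X /H] := penrose_exists M. Qed.

Lemma penrose_unique q r (M : 'M[R]_(q, r)) X Y :
  penrose M X -> penrose M Y -> X = Y.
Proof.
move=> [M1 X1 MX XM] [M2 Y1 MY YM].
have MXY : M *m X = M *m Y.
  have : M *m Y *m (M *m X) = M *m X by rewrite mulmxA M2.
  by move=> /(congr1 trmx); rewrite trmx_mul MX MY mulmxA M1 => <-.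
have XMY : X *m M = Y *m M.
  have : X *m M *m (Y *m M) = X *m M by rewrite -mulmxA [M *m _]mulmxA M2.
  by move=> /(congr1 trmx); rewrite trmx_mul XM YM -mulmxA [M *m _]mulmxA M1 => <-.
by rewrite -X1 -mulmxA MXY mulmxA XMY.
Qed.

Lemma mpinv_sym q (M : 'M[R]_q) : M^T = M -> (mpinv M)^T = mpinv M.
Proof.
move=> Msym; have [M1 X1 MX XM] := mpinvP M.
apply: penrose_unique (mpinvP M); split.
- by have := congr1 trmx M1; rewrite !trmx_mul Msym mulmxA.
- by have := congr1 trmx X1; rewrite !trmx_mul Msym mulmxA.
- by rewrite trmx_mul trmxK Msym -XM trmx_mul Msym.
- by rewrite trmx_mul trmxK Msym -MX trmx_mul Msym.
Qed.

End PositiveMatrices.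

(** * Two constrained least-squares gains *)

Section GaussMarkov.
Context {R : realType} {q r : nat}.
Variables (F : 'M[R]_(r, q)) (M : 'M[R]_r).
Hypotheses (Mpd : pdmx M) (Ffull : \rank F = q).

Let free_tr : row_free F^T.
Proof. by rewrite /row_free mxrank_tr Ffull. Qed.

Let Pd := invmx (F^T *m invmx M *m F).

Lemma gauss_markov_unbiased : Pd *m F^T *m invmx M *m F = 1%:M.
Proof.
rewrite -!mulmxA [_ *m (_ *m F)]mulmxA mulVmx//.
by rewrite -{2}[F]trmxK; apply/pdmx_unit/pdmx_congr => //; exact: pdmx_inv.
Qed.

(** Multiplied by (W - N)^T, where N is the Gauss-Markov gain and W F = N F,
    the right-hand side vanishes: the error of N is orthogonal to every
    admissible correction. *)
Lemma gauss_markov_normal : Pd *m F^T *m invmx M *m M = Pd *m F^T.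
Proof. by rewrite -mulmxA mulVmx ?mulmx1// pdmx_unit. Qed.

End GaussMarkov.

Section ConstrainedGain.
Context {R : realType} {n l r : nat}.
Variables (M : 'M[R]_l) (K : 'M[R]_(n, l)) (U : 'M[R]_(l, r)) (Sg : 'M[R]_r).
Hypotheses (Msym : M^T = M) (UU : U^T *m U = 1%:M) (Su : Sg \in unitmx).
(* M plays the covariance of an innovation and K its covariance with the error
   to be corrected. The constraint W U = 0 is compatible with a singular M
   because the null directions of M are orthogonal to U. *)
Hypothesis M_psd : forall z : 'cV[R]_l, z^T *m M *m z = 0 -> M *m z = 0.
Hypothesis M_U : forall q (z : 'M[R]_(l, q)), M *m z = 0 -> U^T *m z = 0.
Hypothesis M_K : forall q (z : 'M[R]_(l, q)), M *m z = 0 -> K *m z = 0.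

Let X := mpinv M.
Let Pi := U^T *m X *m U.
Let Mstar := invmx Sg *m invmx Pi *m U^T *m X.
Let L := K *m (1%:M - U *m Sg *m Mstar)^T *m X.

Lemma ker_mpinv : M *m (1%:M - X *m M) = 0.
Proof.
by have [MXM _ _ _] := mpinvP M; rewrite mulmxBr mulmx1 mulmxA MXM subrr.
Qed.

Let UXM : U^T *m X *m M = U^T.
Proof.
by apply/eqP; rewrite -mulmxA eq_sym -subr_eq0 -{1}[U^T]mulmx1 -mulmxBr M_U ?ker_mpinv.
Qed.

Let KXM : K *m X *m M = K.
Proof.
by apply/eqP; rewrite -mulmxA eq_sym -subr_eq0 -{1}[K]mulmx1 -mulmxBr M_K ?ker_mpinv.
Qed.

Let Xsym : X^T = X. Proof. exact: mpinv_sym. Qed.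

Let MXU : M *m X *m U = U.
Proof. by have := congr1 trmx UXM; rewrite !trmx_mul trmxK Msym Xsym mulmxA. Qed.

Let Pi_unit : Pi \in unitmx.
Proof.
apply: kernel0_unitmx => x Pix.
have [_ XMX _ _] := mpinvP M.
have : M *m (X *m U *m x) = 0.
  apply: M_psd; rewrite !trmx_mul Xsym.
  have XMX' q (Y : 'M[R]_(q, _)) : Y *m X *m M *m X = Y *m X.
    by rewrite -2!mulmxA (mulmxA X) XMX.
  rewrite !mulmxA XMX'.
  by rewrite -!mulmxA (mulmxA X) (mulmxA U^T) (mulmxA U^T) -/Pi Pix mulmx0.
by rewrite !mulmxA MXU => /(congr1 (mulmx U^T)); rewrite mulmxA UU mul1mx mulmx0.
Qed.

Let MstarT : (U *m Sg *m Mstar)^T = X *m U *m (invmx Pi) *m U^T.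
Proof.
rewrite /Mstar !mulmxA mulmxK// !trmx_mul trmxK Xsym trmx_inv !mulmxA.
by rewrite /Pi !trmx_mul trmxK Xsym mulmxA.
Qed.

(** The factor (1 - U Sg Mstar)^T is an oblique projection that
    annihilates X U. *)
Lemma constrained_gain_unbiased : L *m U = 0.
Proof.
rewrite /L linearB/= trmx1 MstarT mulmxBr mulmx1 !mulmxBl.
rewrite -!mulmxA [U^T *m (X *m U)]mulmxA mulVmx// mulmx1.
by rewrite subrr.
Qed.

(** K - L M is a multiple of U^T: this is the Lagrange condition for the
    minimization of the error covariance under the constraint W U = 0. It
    rests on K X M = K and U^T X M = U^T, which hold because the null space of
    M is contained in those of K and of U^T. *)
Lemma constrained_gain_normal q (W : 'M[R]_(q, l)) : W *m U = 0 -> (K - L *m M) *m W^T = 0.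
Proof.
move=> WU; rewrite /L linearB/= trmx1 MstarT mulmxBr mulmx1 !mulmxBl.
rewrite KXM opprB addrC subrK !mulmxA.
have UXM' q' (Y : 'M[R]_(q', _)) : Y *m U^T *m X *m M = Y *m U^T.
  by rewrite -2!mulmxA (mulmxA U^T) UXM.
rewrite UXM'.
by have := congr1 trmx WU; rewrite trmx_mul trmx0 -(mulmxA _ U^T) => ->; rewrite mulmx0.
Qed.

End ConstrainedGain.

(** * The singular value decomposition decouples the output *)

Section Decoupling.
Context {R : realType} {n m p l : nat}.
Context (S : @system R n m p l) (s : svd_factors (sysH S)).
Hypotheses (Hsvd : is_svd s) (HR : forall k, pdmx (sysR S k)).
Local Notation Rv := (sysR S).
Local Notation U1 := (svdU1 s).
Local Notation U2 := (svdU2 s).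
Local Notation V1 := (svdV1 s).
Local Notation V2 := (svdV2 s).
Local Notation Sg := (svdS s).
Variable k : nat.

Lemma svd_U_blocks :
  [/\ (U1 k)^T *m U1 k = 1%:M, (U1 k)^T *m U2 k = 0, (U2 k)^T *m U1 k = 0
    & (U2 k)^T *m U2 k = 1%:M].
Proof.
have [[_ UU] _ _ _ _] := Hsvd k.
move: UU; rewrite tr_row_mx mul_col_row -[1%:M]submxK => /eq_block_mx[-> -> -> ->].
by split; apply/matrixP => i j; rewrite !mxE ?eq_lshift ?eq_rshift ?eq_lrshift ?eq_rlshift.
Qed.

Lemma svd_V_blocks :
  [/\ (V1 k)^T *m V1 k = 1%:M, (V1 k)^T *m V2 k = 0, (V2 k)^T *m V1 k = 0
    & (V2 k)^T *m V2 k = 1%:M].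
Proof.
have [_ [_ VV] _ _ _] := Hsvd k.
move: VV; rewrite tr_row_mx mul_col_row -[1%:M]submxK => /eq_block_mx[-> -> -> ->].
by split; apply/matrixP => i j; rewrite !mxE ?eq_lshift ?eq_rshift ?eq_lrshift ?eq_rlshift.
Qed.

Lemma svd_U_decomp : U1 k *m (U1 k)^T + U2 k *m (U2 k)^T = 1%:M.
Proof. by have [[<- _] _ _ _ _] := Hsvd k; rewrite tr_row_mx mul_row_col. Qed.

Lemma svd_V_decomp : V1 k *m (V1 k)^T + V2 k *m (V2 k)^T = 1%:M.
Proof. by have [_ [<- _] _ _ _] := Hsvd k; rewrite tr_row_mx mul_row_col. Qed.

Lemma svd_H : sysH S k = U1 k *m Sg k *m (V1 k)^T.
Proof.
have [_ _ _ _ HE] := Hsvd k; apply: etrans HE _.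
by rewrite mul_row_block !mulmx0 !addr0 tr_row_mx mul_row_col mul0mx addr0.
Qed.

Lemma svd_S_unit : Sg k \in unitmx.
Proof. by have [_ _ _ ->] := Hsvd k. Qed.

Lemma svd_S_sym : (Sg k)^T = Sg k.
Proof.
have [_ _ /is_diag_mxP diagS _ _] := Hsvd k.
apply/matrixP => i j; rewrite mxE.
by have [->//|ij] := eqVneq i j; rewrite !diagS// eq_sym.
Qed.

Lemma M1_sym : (M1 s k)^T = M1 s k.
Proof. by rewrite /M1 trmx_inv svd_S_sym. Qed.

Lemma R2_pd : pdmx (R2 s k).
Proof.
apply: pdmx_congr => //; rewrite /T2 /row_free.
have [_ _ _ UU] := svd_U_blocks.
by rewrite -/(row_free _); apply/row_freeP; exists (U2 k).
Qed.

Lemma T1U1 : T1 s k *m U1 k = 1%:M.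
Proof.
have [U11 _ U21 _] := svd_U_blocks.
by rewrite /T1 mulmxBl U11 -(mulmxA _ _ (U1 k)) U21 mulmx0 subr0.
Qed.

Lemma T2U1 : T2 s k *m U1 k = 0.
Proof. by have [] := svd_U_blocks. Qed.

Lemma R1_pd : pdmx (R1 s k).
Proof. by apply: pdmx_congr => //; apply/row_freeP; exists (U1 k); exact: T1U1. Qed.

(** The noises T1 v and T2 v are uncorrelated: T1 is U1^T corrected by
    the regression of U1^T v on U2^T v. *)
Lemma T1RU2 : T1 s k *m Rv k *m U2 k = 0.
Proof.
have U2u : (U2 k)^T *m Rv k *m U2 k \in unitmx.
  by apply: pdmx_unit; have := R2_pd; rewrite /R2 /T2 trmxK.
rewrite /T1 !mulmxBl -!mulmxA (mulmxA (U2 k)^T) mulVmx// mulmx1.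
by rewrite subrr.
Qed.

Lemma T1R : T1 s k *m Rv k = R1 s k *m (U1 k)^T.
Proof.
have T1RU : T1 s k *m Rv k = T1 s k *m Rv k *m U1 k *m (U1 k)^T.
  rewrite -[LHS]mulmx1 -svd_U_decomp mulmxDr (mulmxA _ (U2 k)) T1RU2 mul0mx addr0.
  by rewrite mulmxA.
rewrite /R1 T1RU; congr (_ *m _).
have := congr1 trmx T1U1; rewrite trmx_mul trmx1 => UT.
by rewrite -(mulmxA _ (U1 k)^T (T1 s k)^T) UT mulmx1.
Qed.

(** As T1 R annihilates U2, it factors through U1^T. Hence T1 v is
    uncorrelated with any L v for which L U1 = 0. *)
Lemma RT1 : Rv k *m (T1 s k)^T = U1 k *m R1 s k.
Proof.
have := congr1 trmx T1R.
by rewrite (trmx_mul (T1 s k)) (trmx_mul (R1 s k)) trmxK (HR k).1 R1_pd.1.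
Qed.

Lemma T1H : T1 s k *m sysH S k = Sg k *m (V1 k)^T.
Proof. by apply: etrans (congr1 (mulmx _) svd_H) _; rewrite !mulmxA T1U1 mul1mx. Qed.

Lemma T2H : T2 s k *m sysH S k = 0.
Proof. by apply: etrans (congr1 (mulmx _) svd_H) _; rewrite !mulmxA T2U1 !mul0mx. Qed.

(** A gain cancels the unknown input in the output exactly when it
    annihilates U1, whose columns span the range of H. *)
Lemma gain_H0 q (W : 'M[R]_(q, l)) : W *m sysH S k = 0 <-> W *m U1 k = 0.
Proof.
have WHE : W *m sysH S k = W *m U1 k *m Sg k *m (V1 k)^T.
  by apply: etrans (congr1 (mulmx W) svd_H) _; rewrite !mulmxA.
rewrite WHE; split=> [WH|->]; last by rewrite !mul0mx.
have [V11 _ _ _] := svd_V_blocks.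
have := congr1 (fun Z => Z *m V1 k *m invmx (Sg k)) WH.
by rewrite !mul0mx -(mulmxA _ _ (V1 k)) V11 mulmx1 mulmxK// svd_S_unit.
Qed.

End Decoupling.

(** * One step of the filter *)

Section Step.
Context {dsp : measure_display} {T : measurableType dsp} {R : realType}.
Variable P : probability T R.
Local Notation V := (cvar P).
Context {n m p l : nat}.
Context (S : @system R n m p l) (s : svd_factors (sysH S)).
Hypotheses (Hsvd : is_svd s) (HR : forall k, pdmx (sysR S k)).
Local Notation Rv := (sysR S).
Local Notation C := (sysC S).
Local Notation U1 := (svdU1 s).
Local Notation U2 := (svdU2 s).
Local Notation Sg := (svdS s).

(* e1 is the prediction error without the term of d_{2,k}, v the output noise at
   time k+1, z the noise on the residual from which d_{2,k} is estimated, and es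
   the error of the estimate xstar. *)
Variables (k : nat) (Pt Ps : 'M[R]_n) (e1 : 'cV[V]_n) (v : 'cV[V]_l).
Hypotheses (Hrk : \rank (C2 s k.+1 *m G2 s k) = (p - \rank (sysH S k))%N).
Hypotheses (Cov_e1 : Cov e1 e1 = Pt) (Cov_e1v : Cov e1 v = 0)
  (Cov_v : Cov v v = Rv k.+1).

Let N := M2 s k Pt.
Let z := C2 s k.+1 ** e1 + T2 s k.+1 ** v.
Let es := e1 - G2 s k ** (N ** z).
Let F := C2 s k.+1 *m G2 s k.

Let Cov_ve1 : Cov v e1 = 0. Proof. by rewrite -CovC Cov_e1v trmx0. Qed.
Let Rsym : (Rv k.+1)^T = Rv k.+1. Proof. exact: (HR k.+1).1. Qed.

Lemma Cov_e1_z : Cov e1 z = Pt *m (C2 s k.+1)^T.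
Proof. by rewrite CovDr !CovMr Cov_e1v mul0mx addr0 Cov_e1. Qed.

Lemma Cov_z : Cov z z = Rtilde2 s k Pt.
Proof.
by rewrite CovDl CovMl Cov_e1_z CovMl CovDr !CovMr Cov_ve1 mul0mx add0r Cov_v !mulmxA.
Qed.

(** The output noise is nondegenerate, so that this residual covariance is
    invertible whatever the state covariance is. *)
Lemma Rtilde2_pd : pdmx (Rtilde2 s k Pt).
Proof.
apply: pdmx_add_psd; last exact: R2_pd.
by rewrite -Cov_e1 -CovMl -CovMr; exact: Cov_psd.
Qed.

Let Pd2E : Pd2 s k Pt = invmx (F^T *m invmx (Rtilde2 s k Pt) *m F).
Proof. by rewrite /Pd2 /F (trmx_mul (C2 s k.+1)) !mulmxA. Qed.

Let M2E : N = Pd2 s k Pt *m F^T *m invmx (Rtilde2 s k Pt).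
Proof. by rewrite /N /M2 /F (trmx_mul (C2 s k.+1)) !mulmxA. Qed.

Lemma M2_unbiased : N *m F = 1%:M.
Proof. by rewrite M2E Pd2E gauss_markov_unbiased//; exact: Rtilde2_pd. Qed.

Lemma M2_normal : N *m Rtilde2 s k Pt = Pd2 s k Pt *m F^T.
Proof. by rewrite M2E Pd2E gauss_markov_normal//; exact: Rtilde2_pd. Qed.

Lemma Cov_d2 : Cov (N ** z) (N ** z) = Pd2 s k Pt.
Proof.
rewrite CovMl CovMr Cov_z mulmxA M2_normal -mulmxA.
by have := congr1 trmx M2_unbiased; rewrite trmx_mul trmx1 => ->; rewrite mulmx1.
Qed.

(** The error on d_{2,k} is - N z with N F = 1; two such gains differ by a
    gain that annihilates F, and N z is uncorrelated with the resulting
    correction. *)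
Lemma M2_optimal W : W *m F = 1%:M ->
  \tr (Cov (- (N ** z)) (- (N ** z))) <= \tr (Cov (- (W ** z)) (- (W ** z))).
Proof.
move=> WF.
have -> : - (W ** z) = - (N ** z) - (W - N) ** z.
  by rewrite actBl opprB addrA addNr add0r.
apply: orthogonality_principle.
rewrite CovNl CovMl Cov_z M2_normal mulNmx -mulmxA.
have : (W - N) *m F = 0 by rewrite mulmxBl WF M2_unbiased subrr.
by move=> /(congr1 trmx); rewrite trmx_mul trmx0 => ->; rewrite mulmx0 oppr0.
Qed.

Lemma esE : es = (1%:M - G2 s k *m N *m C2 s k.+1) ** e1
  - (G2 s k *m N *m T2 s k.+1) ** v.
Proof. by rewrite actBl act1 /es /z !actDr -!act_mulmx !mulmxA opprD addrA. Qed.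

Lemma Cov_es_v : Cov es v = - GMUR s k Pt.
Proof.
by rewrite esE CovBl !CovMl Cov_e1v mulmx0 sub0r Cov_v /GMUR /T2 !mulmxA.
Qed.

Lemma Cov_v_es : Cov v es = - (GMUR s k Pt)^T.
Proof. by rewrite -CovC Cov_es_v linearN. Qed.

(** The error es depends on v only through T2 v, which is uncorrelated
    with T1 v. *)
Lemma GMUR_T1 : GMUR s k Pt *m (T1 s k.+1)^T = 0.
Proof.
rewrite /GMUR -(mulmxA _ (Rv _)) RT1// !mulmxA -(mulmxA _ _ (U1 _)).
by have [_ _ -> _] := svd_U_blocks Hsvd k.+1; rewrite mulmx0 !mul0mx.
Qed.

Lemma GMUR_tr : (GMUR s k Pt)^T = Rv k.+1 *m U2 k.+1 *m N^T *m (G2 s k)^T.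
Proof.
rewrite /GMUR -/N trmx_mul (trmx_mul (G2 s k *m N)) (trmx_mul (G2 s k)).
by rewrite trmxK Rsym !mulmxA.
Qed.

Lemma ulise_Cov_es : Cov es es =
  let J := 1%:M - G2 s k *m N *m C2 s k.+1 in
  G2 s k *m N *m R2 s k.+1 *m N^T *m (G2 s k)^T + J *m Pt *m J^T.
Proof.
rewrite /= esE; set J := 1%:M - _.
rewrite CovBl !CovBr !CovMl !CovMr Cov_e1v Cov_ve1 !mul0mx !mulmx0.
rewrite subr0 sub0r opprK Cov_e1 Cov_v /R2 addrC.
by rewrite (trmx_mul (G2 s k *m N)) (trmx_mul (G2 s k)) !mulmxA.
Qed.

Hypothesis (Cov_es : Cov es es = Ps).

Let inn := C k.+1 ** es + v.

Lemma Cov_es_inn : Cov es inn = Kgain s k Pt Ps.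
Proof. by rewrite CovDr CovMr Cov_es Cov_es_v. Qed.

Lemma Cov_inn : Cov inn inn = Rstar s k Pt Ps.
Proof.
rewrite CovDl CovMl Cov_es_inn CovDr CovMr Cov_v_es Cov_v GMUR_tr.
rewrite /Kgain mulmxBr mulNmx (mulmxA _ Ps) /Rstar.
by rewrite [_ + Rv _]addrC addrA [_ - _ + Rv _]addrAC.
Qed.

(** The part T1 v of the innovation is uncorrelated with es and
    nondegenerate; this is what keeps U1 away from the null space of the
    innovation covariance. *)
Lemma Cov_T1v_inn : Cov (T1 s k.+1 ** v) inn = R1 s k.+1 *m (U1 k.+1)^T.
Proof.
rewrite CovMl CovDr CovMr Cov_v_es Cov_v mulmxDr T1R//.
have := congr1 trmx GMUR_T1; rewrite trmx_mul trmxK trmx0 => TG.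
by rewrite mulmxA mulmxN TG oppr0 mul0mx add0r.
Qed.

Local Notation M := (Rstar s k Pt Ps).
Let LL := L s k Pt Ps.

Lemma Rstar_sym : M^T = M. Proof. by rewrite -Cov_inn CovC. Qed.

Lemma Rstar_null q (x : 'M[R]_(l, q)) r (Y : 'cV[V]_r) :
  x^T *m M *m x = 0 -> Cov Y inn *m x = 0.
Proof. by move=> x0; apply: Cov_ker; rewrite Cov_inn. Qed.

Lemma Rstar_null_U1 q (x : 'M[R]_(l, q)) : M *m x = 0 -> (U1 k.+1)^T *m x = 0.
Proof.
move=> Mx; have := @Rstar_null _ x _ (T1 s k.+1 ** v).
rewrite -mulmxA Mx mulmx0 => /(_ erefl).
rewrite Cov_T1v_inn -mulmxA => /(congr1 (mulmx (invmx (R1 s k.+1)))).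
by rewrite mulKmx ?mulmx0//; apply: pdmx_unit; exact: R1_pd.
Qed.

Let Rstar_null_Kgain q (x : 'M[R]_(l, q)) :
  M *m x = 0 -> Kgain s k Pt Ps *m x = 0.
Proof.
by move=> Mx; rewrite -Cov_es_inn; apply: Rstar_null; rewrite -mulmxA Mx mulmx0.
Qed.

Let Rstar_psd (x : 'cV[R]_l) : x^T *m M *m x = 0 -> M *m x = 0.
Proof. by move=> /(@Rstar_null _ x _ inn); rewrite Cov_inn. Qed.

Let U1_orth : (U1 k.+1)^T *m U1 k.+1 = 1%:M.
Proof. by have [] := svd_U_blocks Hsvd k.+1. Qed.

Lemma L_unbiased : LL *m U1 k.+1 = 0.
Proof.
apply: constrained_gain_unbiased => //.
- exact: Rstar_sym.
- exact: svd_S_unit.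
- exact: Rstar_null_U1.
Qed.

(** Admissible gains differ by a gain that annihilates U1, and the Lagrange
    condition makes the error of L uncorrelated with the correction. *)
Lemma L_optimal W : W *m U1 k.+1 = 0 ->
  \tr (Cov (es - LL ** inn) (es - LL ** inn))
    <= \tr (Cov (es - W ** inn) (es - W ** inn)).
Proof.
move=> WU.
have -> : es - W ** inn = (es - LL ** inn) - (W - LL) ** inn.
  by rewrite actBl opprB addrA subrK.
apply: orthogonality_principle; rewrite CovBl CovMl Cov_es_inn Cov_inn.
apply: constrained_gain_normal => //.
- exact: Rstar_sym.
- exact: svd_S_unit.
- exact: Rstar_null_U1.
- by rewrite mulmxBl WU L_unbiased subrr.
Qed.

Let e := es - LL ** inn.

Lemma eE : e = (1%:M - LL *m C k.+1) ** es - LL ** v.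
Proof. by rewrite actBl act1 act_mulmx /e /inn actDr opprD addrA. Qed.

Lemma Cov_e : Cov e e = Pxnext s k Pt Ps.
Proof.
rewrite eE /Pxnext -/LL; set J := 1%:M - _.
rewrite CovBl !CovBr !CovMl !CovMr Cov_es Cov_es_v Cov_v_es Cov_v GMUR_tr.
move: (GMUR s k Pt) => g; rewrite !(mulmxN, mulNmx) opprB !opprK !mulmxA.
by rewrite addrA [_ + J *m g *m _ + LL *m Rv _ *m _]addrAC.
Qed.

(** Both es and L v are uncorrelated with T1 v, the latter because L
    annihilates U1. In ULISE, this is why the covariance of the next
    prediction error is given by a short formula. *)
Lemma Cov_e_T1v : Cov e v *m (T1 s k.+1)^T = 0.
Proof.
rewrite eE CovBl !CovMl Cov_es_v Cov_v mulmxBl -(mulmxA LL) RT1//.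
rewrite -(mulmxA (1%:M - _)) mulNmx GMUR_T1 oppr0 mulmx0.
by rewrite (mulmxA LL (U1 _)) L_unbiased mul0mx subr0.
Qed.

Lemma Cov_es_T1v : Cov es v *m (T1 s k.+1)^T = 0.
Proof. by rewrite Cov_es_v mulNmx GMUR_T1 oppr0. Qed.

Lemma Cov_e_es : Cov e es = (1%:M - LL *m C k.+1) *m Ps
   + LL *m Rv k.+1 *m U2 k.+1 *m N^T *m (G2 s k)^T.
Proof.
by rewrite eE CovBl !CovMl Cov_es Cov_v_es GMUR_tr mulmxN opprK !mulmxA.
Qed.

End Step.

(** * The error recursion and the covariance recursions *)

Section Errors.
Context {dsp : measure_display} {T : measurableType dsp} {R : realType}.
Variable P : probability T R.
Local Notation V := (cvar P).
Context {n m p l : nat}.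
Context (S : @system R n m p l) (s : svd_factors (sysH S)).
Local Notation Rv := (sysR S).
Local Notation A := (sysA S).
Local Notation C := (sysC S).
Local Notation U1 := (svdU1 s).
Local Notation U2 := (svdU2 s).
Local Notation Sg := (svdS s).
Local Notation pH k := (\rank (sysH S k)).

Variables (e0 : 'cV[V]_n) (w : nat -> 'cV[V]_n) (v : nat -> 'cV[V]_l).

(** The recursion obeyed by the estimation errors once the gains cancel the
    unknown input: it involves only the initial error and the noises. *)
Section AnyGains.
Variables (a : algorithm) (g : gains S).

Definition d1err k (e : 'cV[V]_n * 'cV[V]_n) : 'cV[V]_(pH k) :=
  - (M1gain g k ** (C1 s k ** (match a with ULISE => e.2 | PLISE => e.1 end)
                    + T1 s k ** v k)).
Definition prederr k e : 'cV[V]_n :=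
  A k ** e.2 + G1 s k ** d1err k e + w k.
Definition noise2 k (e1 : 'cV[V]_n) : 'cV[V]_(l - pH k.+1) :=
  C2 s k.+1 ** e1 + T2 s k.+1 ** v k.+1.

(** The pair of the errors of xstar and of the final state estimate; they
    coincide at time 0, where no measurement has been used. *)
Fixpoint err k : 'cV[V]_n * 'cV[V]_n :=
  if k is k'.+1 then
    let e1 := prederr k' (err k') in
    let es := e1 - G2 s k' ** (M2gain g k' ** noise2 k' e1) in
    (es, es - Lgain g k'.+1 ** (C k'.+1 ** es + v k'.+1))
  else (e0, e0).

Hypotheses (e0w : forall k, Cov e0 (w k) = 0) (e0v : forall k, Cov e0 (v k) = 0).
Hypothesis (wv : forall j k, Cov (w j) (v k) = 0).
Hypothesis (ww : forall j k, j != k -> Cov (w j) (w k) = 0).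
Hypothesis (vv : forall j k, j != k -> Cov (v j) (v k) = 0).

Let vw j k : Cov (v j) (w k) = 0. Proof. by rewrite -CovC wv trmx0. Qed.

(** At time k the errors involve v_0, ..., v_k but only w_0, ..., w_(k-1),
    whence the two different inequalities. *)
Definition uncorrelated_future k q (X : 'cV[V]_q) :=
  (forall j, (k <= j)%N -> Cov X (w j) = 0) /\
  (forall j, (k < j)%N -> Cov X (v j) = 0).

Lemma uncorrelated_futureW k k' q (X : 'cV[V]_q) : (k <= k')%N ->
  uncorrelated_future k X -> uncorrelated_future k' X.
Proof.
by move=> kk' [Xw Xv]; split=> j jk; [apply: Xw|apply: Xv]; exact: leq_trans jk.
Qed.

Lemma uncorrelated_futureD k q (X Y : 'cV[V]_q) :
  uncorrelated_future k X -> uncorrelated_future k Y -> uncorrelated_future k (X + Y).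
Proof.
move=> [Xw Xv] [Yw Yv].
by split=> j jk; rewrite CovDl ?Xw ?Yw ?Xv ?Yv ?addr0.
Qed.

Lemma uncorrelated_futureN k q (X : 'cV[V]_q) :
  uncorrelated_future k X -> uncorrelated_future k (- X).
Proof. by move=> [Xw Xv]; split=> j jk; rewrite CovNl ?Xw ?Xv ?oppr0. Qed.

Lemma uncorrelated_future_act k q r (M : 'M[R]_(r, q)) (X : 'cV[V]_q) :
  uncorrelated_future k X -> uncorrelated_future k (M ** X).
Proof. by move=> [Xw Xv]; split=> j jk; rewrite CovMl ?Xw ?Xv ?mulmx0. Qed.

Lemma uncorrelated_future_v k : uncorrelated_future k (v k).
Proof. by split=> j jk; [exact: vw|rewrite vv// ltn_eqF]. Qed.

Lemma uncorrelated_future_w k : uncorrelated_future k.+1 (w k).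
Proof. by split=> j jk; [rewrite ww// ltn_eqF|exact: wv]. Qed.

Lemma d1err_future k e : uncorrelated_future k e.1 -> uncorrelated_future k e.2 ->
  uncorrelated_future k (d1err k e).
Proof.
move=> e1 e2; apply/uncorrelated_futureN/uncorrelated_future_act/uncorrelated_futureD.
  by apply: uncorrelated_future_act; case: a.
by apply: uncorrelated_future_act; exact: uncorrelated_future_v.
Qed.

Lemma err_future k : uncorrelated_future k (err k).1 /\ uncorrelated_future k (err k).2.
Proof.
elim: k => [|k [IH1 IH2]]; first by split; split=> j _ /=.
have e1F : uncorrelated_future k.+1 (prederr k (err k)).
  apply/uncorrelated_futureD/uncorrelated_future_w.
  apply: (@uncorrelated_futureW k) => //.
  by apply: uncorrelated_futureD; apply: uncorrelated_future_act => //; exact: d1err_future.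
have vF := uncorrelated_future_v k.+1.
have esF : uncorrelated_future k.+1 (err k.+1).1.
  apply/uncorrelated_futureD/uncorrelated_futureN => //.
  do 2 apply: uncorrelated_future_act.
  by apply: uncorrelated_futureD; exact: uncorrelated_future_act.
split=> //; apply/uncorrelated_futureD/uncorrelated_futureN => //.
by apply/uncorrelated_future_act/uncorrelated_futureD/vF/uncorrelated_future_act.
Qed.

Lemma prederr_v k : Cov (prederr k (err k)) (v k.+1) = 0.
Proof.
have [[_ h1] [_ h2]] := err_future k.
have [_ hd] := @d1err_future k (err k) (err_future k).1 (err_future k).2.
by rewrite !CovDl !CovMl h2// hd// wv !mulmx0 !addr0.
Qed.

Lemma err_w k : Cov (err k).2 (w k) = 0.
Proof. by have [_ [-> //]] := err_future k. Qed.

Lemma d1err_w k : Cov (d1err k (err k)) (w k) = 0.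
Proof. by have [] := @d1err_future k (err k) (err_future k).1 (err_future k).2 => ->. Qed.

End AnyGains.

Hypotheses (Hsvd : is_svd s) (HR : forall k, pdmx (sysR S k)).
Hypothesis (Hrk : forall k, \rank (C2 s k.+1 *m G2 s k) = (p - pH k)%N).
Variable P0 : 'M[R]_n.
Hypotheses (e0e0 : Cov e0 e0 = P0)
  (e0w : forall k, Cov e0 (w k) = 0) (e0v : forall k, Cov e0 (v k) = 0)
  (wv : forall j k, Cov (w j) (v k) = 0)
  (ww : forall j k, Cov (w j) (w k) = if j == k then sysQ S k else 0)
  (vv : forall j k, Cov (v j) (v k) = if j == k then sysR S k else 0).

Let ww' j k : j != k -> Cov (w j) (w k) = 0.
Proof. by move=> /negPf jk; rewrite ww jk. Qed.
Let vv' j k : j != k -> Cov (v j) (v k) = 0.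
Proof. by move=> /negPf jk; rewrite vv jk. Qed.
Let wE k : Cov (w k) (w k) = sysQ S k. Proof. by rewrite ww eqxx. Qed.
Let vE k : Cov (v k) (v k) = sysR S k. Proof. by rewrite vv eqxx. Qed.

Definition alg_Px a k := match a with
  | ULISE => ulise_Px s P0 k | PLISE => covx (plise_covs s P0 k) end.
Definition alg_Pt a k := match a with
  | ULISE => ulise_Pt s k (ulise_Px s P0 k) | PLISE => plise_Pt s (plise_covs s P0 k) end.
Definition alg_Ps a k := match a with
  | ULISE => ulise_Ps s k (ulise_Px s P0 k) | PLISE => plise_Ps s (plise_covs s P0 k) end.

Local Notation gain a := (algorithm_gains s P0 a).

Lemma M1_alg a k : M1gain (gain a) k = M1 s k. Proof. by case: a. Qed.
Lemma M2_alg a k : M2gain (gain a) k = M2 s k (alg_Pt a k). Proof. by case: a. Qed.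
Lemma L_alg a k : Lgain (gain a) k.+1 = L s k (alg_Pt a k) (alg_Ps a k).
Proof. by case: a. Qed.
Lemma Px_alg a k : alg_Px a k.+1 = Pxnext s k (alg_Pt a k) (alg_Ps a k).
Proof. by case: a. Qed.

Local Notation er a := (err a (gain a)).
Local Notation eps a k := (prederr a (gain a) k (er a k)).

(** The induction hypothesis: the matrices propagated by the algorithm are
    the covariances of the errors. PLISE estimates d_{1,k} from xstar and has
    to propagate the covariances of the error of xstar as well. *)
Definition tracks a k :=
  [/\ Cov (er a k).2 (er a k).2 = alg_Px a k,
      Cov (er a k).2 (v k) *m (T1 s k)^T = 0 &
      a = PLISE ->
      [/\ Cov (er a k).1 (er a k).1 = covxs (plise_covs s P0 k),
          Cov (er a k).1 (v k) *m (T1 s k)^T = 0 &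
          Cov (er a k).2 (d1err a (gain a) k (er a k)) = covxd1 (plise_covs s P0 k)]].

Lemma Cov_eps_v a k : Cov (eps a k) (v k.+1) = 0.
Proof. exact: prederr_v. Qed.

(** The prediction error is Ahat e - G1 M1 T1 v + w, a sum of uncorrelated
    terms. *)
Lemma Cov_eps_ULISE k :
  tracks ULISE k -> Cov (eps ULISE k) (eps ULISE k) = alg_Pt ULISE k.
Proof.
move=> [ePx eT1 _].
have ew := err_w ULISE (gain ULISE) e0w e0v wv ww' vv' k.
set e := (er ULISE k).2 in ePx eT1 ew.
have -> : eps ULISE k =
    Ahat s k ** e - (G1 s k *m M1 s k) ** (T1 s k ** v k) + w k.
  rewrite /prederr /d1err /= -/e /Ahat (actBl (A k)) actNr !actDr -!act_mulmx !mulmxA.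
  by rewrite opprD !addrA.
set u := T1 s k ** v k.
have eu : Cov e u = 0 by rewrite CovMr.
have uw : Cov u (w k) = 0 by rewrite CovMl -CovC wv trmx0 mulmx0.
have uu : Cov u u = R1 s k by rewrite CovMl CovMr vE mulmxA.
clearbody u.
rewrite Cov_uncorrelatedD; last first.
  by rewrite CovDl CovNl !CovMl ew uw !mulmx0 subr0.
rewrite Cov_uncorrelatedD; last by rewrite CovNr CovMl CovMr eu mul0mx mulmx0 oppr0.
rewrite CovNl CovNr opprK !CovMl !CovMr ePx uu wE /= /ulise_Pt /Qhat addrA.
rewrite (trmx_mul (G1 s k)) !mulmxA.
by [].
Qed.

Lemma Cov_d1_PLISE k : tracks PLISE k ->
  let d1 := d1err PLISE (gain PLISE) k (er PLISE k) in
  Cov d1 d1 = plise_Pd1 s (plise_covs s P0 k).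
Proof.
move=> [_ _ /(_ erefl)[esPs esT1 _]] /=.
rewrite /d1err /= CovNl CovNr opprK CovMl CovMr Cov_uncorrelatedD; last first.
  by rewrite CovMl CovMr esT1 mulmx0.
rewrite !CovMl !CovMr esPs vE /plise_Pd1 /R1 !mulmxA.
by have := M1_sym Hsvd k => ->.
Qed.

(** The error on d_{1,k} is correlated with e, so the joint covariance of
    the two errors has to be propagated. *)
Lemma Cov_eps_PLISE k :
  tracks PLISE k -> Cov (eps PLISE k) (eps PLISE k) = alg_Pt PLISE k.
Proof.
move=> tr; have dd := Cov_d1_PLISE tr.
have [ePx _ /(_ erefl)[_ _ ed1]] := tr.
have ew := err_w PLISE (gain PLISE) e0w e0v wv ww' vv' k.
have dw := d1err_w PLISE (gain PLISE) e0w e0v wv ww' vv' k.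
set d1 := d1err _ _ _ _ in ed1 dw dd.
set e := (er PLISE k).2 in ePx ew ed1.
rewrite /prederr -act_row_col -/d1 -/e Cov_uncorrelatedD; last first.
  by rewrite CovMl Cov_coll ew dw col_mx0 mulmx0.
rewrite CovMl CovMr Cov_coll !Cov_colr -[Cov d1 e]CovC ePx ed1 dd wE mulmxA.
by [].
Qed.

Lemma Cov_eps a k : tracks a k -> Cov (eps a k) (eps a k) = alg_Pt a k.
Proof. by case: a; [exact: Cov_eps_ULISE|exact: Cov_eps_PLISE]. Qed.

Lemma er1S a k : (er a k.+1).1 =
  eps a k - G2 s k ** (M2 s k (alg_Pt a k) ** noise2 k (eps a k)).
Proof. by rewrite -M2_alg. Qed.

Lemma er2S a k : (er a k.+1).2 =
  (er a k.+1).1 - L s k (alg_Pt a k) (alg_Ps a k) ** (C k.+1 ** (er a k.+1).1 + v k.+1).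
Proof. by rewrite -L_alg. Qed.

(** The error of xstar is A e + G1 d1 + G2 d2 + w, where d1 and d2 are the
    errors on the two parts of the input. The error d2 depends on w through the
    residual, and this correlation produces the last two terms of the formula. *)
Lemma Cov_es_PLISE k : tracks PLISE k ->
  Cov (er PLISE k.+1).1 (er PLISE k.+1).1 = alg_Ps PLISE k.
Proof.
move=> tr; have dd := Cov_d1_PLISE tr.
have epsPt := Cov_eps_PLISE tr; have epsv := Cov_eps_v PLISE k.
have [ePx _ /(_ erefl)[_ _ ed1]] := tr.
have ew := err_w PLISE (gain PLISE) e0w e0v wv ww' vv' k.
have dw := d1err_w PLISE (gain PLISE) e0w e0v wv ww' vv' k.
have [[_ esF] [_ eF]] := err_future PLISE (gain PLISE) e0w e0v wv ww' vv' k.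
have ev : Cov (er PLISE k).2 (v k.+1) = 0 by exact: eF.
have dv : Cov (d1err PLISE (gain PLISE) k (er PLISE k)) (v k.+1) = 0.
  by rewrite CovNl CovMl CovDl !CovMl /= esF// vv'// ?mulmx0 ?addr0 ?mulmx0 ?oppr0// ltn_eqF.
rewrite er1S.
pose d2 := - (M2 s k (alg_Pt PLISE k) ** noise2 k (eps PLISE k)).
have d2d2 : Cov d2 d2 = Pd2 s k (alg_Pt PLISE k).
  by rewrite CovNl CovNr opprK; apply: Cov_d2.
have epsE : eps PLISE k = A k ** (er PLISE k).2 
    + G1 s k ** d1err PLISE (gain PLISE) k (er PLISE k) + w k by [].
set d1 := d1err _ _ _ _ in ed1 dw dd dv epsE.
set e := (er PLISE k).2 in ePx ew ed1 ev epsE.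
have d1e : Cov d1 e = (covxd1 (plise_covs s P0 k))^T by rewrite -ed1 CovC.
have Ceps q (X : 'cV[V]_q) : Cov X (w k) = 0 -> Cov X (v k.+1) = 0 ->
    Cov X d2 = - ((Cov X e *m (A k)^T + Cov X d1 *m (G1 s k)^T)
      *m (C2 s k.+1)^T *m (M2 s k (alg_Pt PLISE k))^T).
  move=> Xw Xv; rewrite CovNr CovMr CovDr (CovMr (C2 _ _)) CovMr Xv mul0mx addr0.
  by rewrite epsE !CovDr Xw addr0 !CovMr.
have ed2 : Cov e d2 = plise_Pxd2 s (plise_covs s P0 k).
  by rewrite Ceps// ePx ed1 !mulmxDl opprD.
have d1d2 : Cov d1 d2 = plise_Pd12 s (plise_covs s P0 k).
  by rewrite Ceps// d1e dd !mulmxDl opprD.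
have d2w : Cov d2 (w k) = - (M2 s k (alg_Pt PLISE k) *m C2 s k.+1 *m sysQ S k).
  rewrite CovNl CovMl CovDl (CovMl (C2 _ _)) (CovMl (T2 _ _)) -[Cov (v _) _]CovC wv.
  by rewrite trmx0 mulmx0 addr0 epsE !CovDl !CovMl ew dw !mulmx0 !add0r wE !mulmxA.
pose AG := row_mx (A k) (row_mx (G1 s k) (G2 s k)).
pose eta := col_mx e (col_mx d1 d2).
have -> : eps PLISE k - G2 s k ** (M2 s k (alg_Pt PLISE k) ** noise2 k (eps PLISE k))
   = AG ** eta + w k.
  by rewrite -actNr -/d2 epsE /AG /eta !act_row_col -!addrA; congr (_ + (_ + _)); rewrite addrC.
have etaw : Cov (AG ** eta) (w k) =
    - (G2 s k *m M2 s k (alg_Pt PLISE k) *m C2 s k.+1 *m sysQ S k).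
  rewrite CovMl !Cov_coll ew dw d2w /AG !mul_row_col !mulmx0 !add0r mulmxN.
  by rewrite !mulmxA.
have weta : Cov (w k) (AG ** eta) = - (sysQ S k *m (C2 s k.+1)^T
    *m (M2 s k (alg_Pt PLISE k))^T *m (G2 s k)^T).
  rewrite -CovC etaw linearN /= (trmx_mul (G2 s k *m M2 _ _ _ *m C2 _ _)).
  rewrite (trmx_mul (G2 s k *m M2 _ _ _)) (trmx_mul (G2 s k)) !mulmxA.
  congr (- (_ *m _ *m _ *m _)).
  by rewrite -wE CovC.
rewrite CovDl !CovDr etaw weta wE CovMl CovMr /eta !(Cov_coll, Cov_colr).
rewrite -[Cov d2 e]CovC -[Cov d2 d1]CovC ePx ed1 ed2 d1e dd d1d2 d2d2 mulmxA.
rewrite [- _ + sysQ _ _]addrC addrA [_ - _ + sysQ _ _]addrAC /= /plise_Ps.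
do 3 congr (_ + _); congr (_ *m _ *m _).
rewrite /block_mx; congr col_mx.
exact: block_mxEh.
Qed.

Lemma Cov_es a k : tracks a k -> Cov (er a k.+1).1 (er a k.+1).1 = alg_Ps a k.
Proof.
move=> tr; have epsPt := Cov_eps tr; have epsv := Cov_eps_v a k.
case: a tr epsPt epsv => tr epsPt epsv; last exact: Cov_es_PLISE.
by rewrite er1S; apply: etrans (ulise_Cov_es _ _ _ _) _.
Qed.

Lemma tracksS a k : tracks a k -> tracks a k.+1.
Proof.
move=> tr; have epsPt := Cov_eps tr; have epsv := Cov_eps_v a k.
have esPs := Cov_es tr.
have esT1 : Cov (er a k.+1).1 (v k.+1) *m (T1 s k.+1)^T = 0.
  by rewrite er1S; apply: Cov_es_T1v.
have eT1 : Cov (er a k.+1).2 (v k.+1) *m (T1 s k.+1)^T = 0.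
  by move: esPs; rewrite er2S er1S => esPs; apply: Cov_e_T1v.
split=> //.
- by move: esPs; rewrite Px_alg er2S er1S => esPs; apply: Cov_e.
- move=> aP; split => //; first by rewrite esPs aP.
  move: esPs esT1 eT1 epsPt epsv; rewrite aP => esPs esT1 eT1 epsPt epsv.
  have d1E g x : d1err PLISE g k.+1 x =
    - (M1gain g k.+1 ** (C1 s k.+1 ** x.1 + T1 s k.+1 ** v k.+1)) by [].
  rewrite d1E CovNr CovMr CovDr (CovMr (C1 _ _)) (CovMr (T1 _ _)) eT1 addr0 M1_alg.
  have ees : Cov (er PLISE k.+1).2 (er PLISE k.+1).1 =
      (1%:M - L s k (alg_Pt PLISE k) (alg_Ps PLISE k) *m C k.+1)
        *m alg_Ps PLISE k
      + L s k (alg_Pt PLISE k) (alg_Ps PLISE k) *m Rv k.+1 *m (T2 s k.+1)^T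
        *m (M2 s k (alg_Pt PLISE k))^T *m (G2 s k)^T.
    rewrite /T2 trmxK.
    by move: esPs; rewrite er2S er1S => esPs; apply: Cov_e_es.
  by rewrite ees (mulmxDl (_ *m alg_Ps _ _)) (mulmxDl (_ *m alg_Ps _ _ *m _)) opprD.
Qed.

Lemma tracks0 a : tracks a 0.
Proof.
split=> [||aP]; first by rewrite e0e0; case: a.
  by rewrite e0v mul0mx.
split; rewrite /= ?e0v ?mul0mx// aP.
rewrite /d1err /= CovNr CovMr CovDr (CovMr (C1 _ _)) (CovMr (T1 _ _)) e0v mul0mx addr0.
by rewrite e0e0 (M1_sym Hsvd).
Qed.

Lemma tracksP a k : tracks a k.
Proof. by elim: k => [|k]; [exact: tracks0|exact: tracksS]. Qed.

Lemma alg_M2_unbiased a k : M2gain (gain a) k *m (C2 s k.+1 *m G2 s k) = 1%:M.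
Proof. by rewrite M2_alg; apply: M2_unbiased (Cov_eps (tracksP a k)). Qed.

Lemma alg_M2_optimal a k W : W *m (C2 s k.+1 *m G2 s k) = 1%:M ->
  let z := noise2 k (eps a k) in
  \tr (Cov (- (M2gain (gain a) k ** z)) (- (M2gain (gain a) k ** z)))
    <= \tr (Cov (- (W ** z)) (- (W ** z))).
Proof.
by rewrite M2_alg /= => WF; apply: (M2_optimal Hsvd HR) => //;
  [exact: Cov_eps (tracksP a k)|exact: Cov_eps_v].
Qed.

Lemma alg_L_unbiased a k : Lgain (gain a) k.+1 *m U1 k.+1 = 0.
Proof.
rewrite L_alg; have := Cov_es (tracksP a k); rewrite er1S => esPs.
exact: (L_unbiased Hsvd HR (Cov_eps_v a k) (vE k.+1) esPs).
Qed.

Lemma alg_L_optimal a k W : W *m U1 k.+1 = 0 ->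
  let es := (er a k.+1).1 in let inn := C k.+1 ** es + v k.+1 in
  \tr (Cov (es - Lgain (gain a) k.+1 ** inn) (es - Lgain (gain a) k.+1 ** inn))
    <= \tr (Cov (es - W ** inn) (es - W ** inn)).
Proof.
move=> WU; cbv zeta; have := Cov_es (tracksP a k).
rewrite L_alg er1S => esPs.
exact: (L_optimal Hsvd HR (Cov_eps_v a k) (vE k.+1) esPs WU).
Qed.

End Errors.

(** * The filter obeys the error recursion *)

Section Realization.
Context {dsp : measure_display} {T : measurableType dsp} {R : realType}.
Variable P : probability T R.
Local Notation V := (cvar P).
Context {n m p l : nat}.
Context (S : @system R n m p l) (s : svd_factors (sysH S)).
Hypothesis (Hsvd : is_svd s).
Variables (u : nat -> 'cV[R]_m) (x0 : T -> 'cV[R]_n)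
  (w : nat -> T -> 'cV[R]_n) (v : nat -> T -> 'cV[R]_l) (xhat0 : 'cV[R]_n).
Variables (e0 : 'cV[V]_n) (wV : nat -> 'cV[V]_n) (vV : nat -> 'cV[V]_l).
Hypotheses (x0E : forall t, x0 t - xhat0 = ev e0 t)
  (wE : forall k t, w k t = ev (wV k) t) (vE : forall k t, v k t = ev (vV k) t).

Section Residuals.
Variables (d : nat -> T -> 'cV[R]_p) (t : T).
Let x k := state S u x0 w d k t.
Let y := output S u x0 w v d t.
Local Notation V1 := (svdV1 s).
Local Notation V2 := (svdV2 s).
Local Notation Sg := (svdS s).

Lemma innovation_output k x' :
  innovation S u y k x' = sysC S k *m (x k - x') + ev (vV k) t + sysH S k *m d k t.
Proof.
rewrite /innovation /y /output -/(x k) vE mulmxBr.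
move: (_ *m x k) (_ *m x') (_ *m u k) (_ *m d k t) (ev _ _) => c c' D h r.
by apply/colP => i; rewrite !mxE; ring.
Qed.

Lemma residual1_output k x' : residual1 s u y k x' =
  C1 s k *m (x k - x') + T1 s k *m ev (vV k) t + Sg k *m ((V1 k)^T *m d k t).
Proof.
have -> : residual1 s u y k x' = T1 s k *m innovation S u y k x'.
  by rewrite /innovation !mulmxBr !mulmxA.
rewrite innovation_output 2!mulmxDr !mulmxA.
by rewrite (T1H Hsvd).
Qed.

Lemma residual2_output k x' : residual2 s u y k x' =
  C2 s k *m (x k - x') + T2 s k *m ev (vV k) t.
Proof.
have -> : residual2 s u y k x' = T2 s k *m innovation S u y k x'.
  by rewrite /innovation !mulmxBr !mulmxA.
rewrite innovation_output 2!mulmxDr !mulmxA.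
by rewrite (T2H Hsvd) mul0mx addr0.
Qed.

Variables (a : algorithm) (g : gains S).
(* the three identities by which the unknown input cancels *)
Hypothesis g1 : forall k, M1gain g k = M1 s k.
Hypothesis g2 : forall k, M2gain g k *m (C2 s k.+1 *m G2 s k) = 1%:M.
Hypothesis gL : forall k, Lgain g k.+1 *m svdU1 s k.+1 = 0.
Local Notation er := (err s e0 wV vV a g).
Local Notation eps k := (prederr s wV vV a g k (er k)).

Definition err_ok k :=
  x k - xstar s a g xhat0 u y k = ev (er k).1 t /\
  x k - xhat s a g xhat0 u y k = ev (er k).2 t.

Definition noise1 k : 'cV[V]_(\rank (sysH S k)) :=
  C1 s k ** (match a with ULISE => (er k).2 | PLISE => (er k).1 end) + T1 s k ** vV k.

Lemma r1_output k : err_ok k -> r1 s a g xhat0 u y k =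
  ev (noise1 k) t + Sg k *m ((V1 k)^T *m d k t).
Proof.
move=> [ok1 ok2]; rewrite /r1 /d1_residual residual1_output /noise1 evD !ev_act.
have selE b :
    x k - match b with ULISE => (estimate s a g xhat0 u y k).2
                     | PLISE => (estimate s a g xhat0 u y k).1 end =
    ev (match b with ULISE => (er k).2 | PLISE => (er k).1 end) t.
  by case: b.
by rewrite selE.
Qed.

(** For an arbitrary gain W, so that the coefficient of the unknown input
    decides which gains are unbiased. *)
Lemma d1_error k (W : 'M[R]_(\rank (sysH S k))) : err_ok k ->
  (V1 k)^T *m d k t - W *m r1 s a g xhat0 u y k =
  (((V1 k)^T - W *m Sg k *m (V1 k)^T) *m d k t) + ev (- (W ** noise1 k)) t.
Proof.
move=> ok; rewrite r1_output// mulmxDr evN ev_act mulmxBl !mulmxA.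
by rewrite opprD addrA addrAC.
Qed.

Lemma d1_errorM k : err_ok k ->
  (V1 k)^T *m d k t - d1hat s a g xhat0 u y k = ev (d1err s vV a g k (er k)) t.
Proof.
move=> ok; rewrite d1_error// g1 mulVmx ?svd_S_unit// mul1mx subrr mul0mx add0r.
by rewrite /d1err g1.
Qed.

(** The error on d_{1,k} is part of the prediction error, whereas d_{2,k},
    which cannot be estimated before time k+1, enters in full. *)
Lemma prediction_error k : err_ok k ->
  x k.+1 - predict s a g u y k (estimate s a g xhat0 u y k)
  = ev (eps k) t + G2 s k *m ((V2 k)^T *m d k t).
Proof.
move=> ok; have := d1_errorM ok; move: ok => [_ ok2] d1E.
have xS : x k.+1 = sysA S k *m x k + sysB S k *m u k + sysG S k *m d k t + w k t by [].
have GE : sysG S k *m d k t = G1 s k *m ((V1 k)^T *m d k t) + G2 s k *m ((V2 k)^T *m d k t).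
  rewrite /G1 /G2 !mulmxA -mulmxDl -!(mulmxA (sysG S k)) -mulmxDr svd_V_decomp//.
  by rewrite mulmx1.
have -> : predict s a g u y k (estimate s a g xhat0 u y k) =
  sysA S k *m xhat s a g xhat0 u y k + sysB S k *m u k
  + G1 s k *m d1hat s a g xhat0 u y k by [].
rewrite /prederr !evD !ev_act -d1E -ok2 -wE xS GE !mulmxBr.
move: (_ *m x k) (_ *m u k) (G1 s k *m (_ *m _)) (G2 s k *m _) (w k t)
  (_ *m xhat _ _ _ _ _ _ _) (_ *m d1hat _ _ _ _ _ _ _) => b1 b2 b3 b4 b5 b6 b7.
by apply/colP => i; rewrite !mxE; ring.
Qed.

Lemma r2_output k : err_ok k -> r2 s a g xhat0 u y k =
  ev (noise2 s vV k (eps k)) t + C2 s k.+1 *m G2 s k *m ((V2 k)^T *m d k t).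
Proof.
move=> ok; rewrite /r2 residual2_output prediction_error// /noise2 evD !ev_act mulmxDr.
by rewrite addrAC !mulmxA.
Qed.

Lemma d2_error k (W : 'M[R]_(p - \rank (sysH S k), l - \rank (sysH S k.+1))) : err_ok k ->
  (V2 k)^T *m d k t - W *m r2 s a g xhat0 u y k =
  (((V2 k)^T - W *m (C2 s k.+1 *m G2 s k) *m (V2 k)^T) *m d k t)
  + ev (- (W ** noise2 s vV k (eps k))) t.
Proof.
move=> ok; rewrite r2_output// mulmxDr evN ev_act mulmxBl -!mulmxA.
by rewrite opprD addrA addrAC.
Qed.

Lemma d2_errorM k : err_ok k ->
  (V2 k)^T *m d k t - d2hat s a g xhat0 u y k =
  ev (- (M2gain g k ** noise2 s vV k (eps k))) t.
Proof. by move=> ok; rewrite d2_error// g2 mul1mx subrr mul0mx add0r. Qed.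

Lemma xstar_error k : err_ok k ->
  x k.+1 - xstar s a g xhat0 u y k.+1 = ev (er k.+1).1 t.
Proof.
move=> ok; have := d2_errorM ok; have := prediction_error ok.
have -> : (er k.+1).1 = eps k + G2 s k ** (- (M2gain g k ** noise2 s vV k (eps k))).
  by rewrite actNr.
have -> : xstar s a g xhat0 u y k.+1 =
  predict s a g u y k (estimate s a g xhat0 u y k)
  + G2 s k *m d2hat s a g xhat0 u y k by [].
move: (predict _ _ _ _ _ _ _) => pr; rewrite opprD addrA evD ev_act => -> <-.
by rewrite mulmxBr -addrA.
Qed.

Lemma innov_output k : x k - xstar s a g xhat0 u y k = ev (er k).1 t ->
  innov s a g xhat0 u y k =
  ev (sysC S k ** (er k).1 + vV k) t + sysH S k *m d k t.
Proof. by move=> xE; rewrite /innov innovation_output xE evD ev_act. Qed.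

Lemma state_error k (W : 'M[R]_(n, l)) : x k - xstar s a g xhat0 u y k = ev (er k).1 t ->
  x k - (xstar s a g xhat0 u y k + W *m innov s a g xhat0 u y k) =
  (- (W *m sysH S k)) *m d k t
  + ev ((er k).1 - W ** (sysC S k ** (er k).1 + vV k)) t.
Proof.
move=> xE; rewrite opprD addrA xE innov_output// mulmxDr evB ev_act mulNmx mulmxA.
by rewrite opprD addrA addrC.
Qed.

Lemma err_okP k : err_ok k.
Proof.
elim: k => [|k ok]; first by split; rewrite /= -x0E.
have xsE := xstar_error ok; split=> //.
have := state_error (Lgain g k.+1) xsE.
by rewrite (gain_H0 Hsvd _ _).2 // oppr0 mul0mx add0r => <-.
Qed.

Lemma dhat_error k : d k t - dhat s a g xhat0 u y k =
  ev (V1 k ** d1err s vV a g k (er k) + V2 k ** (- (M2gain g k ** noise2 s vV k (eps k)))) t.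
Proof.
have ok := err_okP k; rewrite evD !ev_act -d1_errorM// -d2_errorM// /dhat.
rewrite !mulmxBr -{1}[d k t]mul1mx -(svd_V_decomp Hsvd k) mulmxDl !mulmxA opprD.
by rewrite !addrA; congr (_ - _); rewrite addrAC.
Qed.

End Residuals.
End Realization.

(** * Optimality *)

Section Unbiasedness.
Context {dsp : measure_display} {T : measurableType dsp} {R : realType}.
Variable P : probability T R.
Local Notation V := (cvar P).

(** Constant unknown inputs are enough to detect a nonzero coefficient. *)
Lemma zero_mean_affine p q (N : 'M[R]_(q, p)) (E : 'cV[V]_q) k :
  (forall d, unknown_input d -> zero_mean P (fun t => N *m d k t + ev E t)) -> N = 0.
Proof.
move=> NE; apply/matrixP => i j; rewrite mxE.
pose d (_ : nat) (_ : T) : 'cV[R]_p := delta_mx j 0.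
have d_in : unknown_input d by move=> k' i'; exact: measurable_cst.
have [_ /eqP] := NE d d_in i.
rewrite (_ : (fun t => _) = cst (N i j) + E i 0); last first.
  apply/funext => t; rewrite !mxE/= (bigD1 j)//= big1 ?addr0; last first.
    by move=> j' /negPf jj; rewrite mxE jj mulr0.
  by rewrite mxE !eqxx mulr1.
rewrite expectationD ?Lfun_cst//; last by exact: Lfun2_Lfun1 (cvar_L2 _).
by rewrite expectation_cst cvar_E adde0 eqe => /eqP.
Qed.

(** If the error of every gain W is N W d_k plus a centered vector that does
    not depend on d, then W is unbiased exactly when N W = 0, its error
    covariance does not depend on d, and optimality reduces to a comparison of
    traces under the constraint N W = 0. *)
Section AffineErrors.
Context {p q r : nat}.
Variables (x b : (nat -> T -> 'cV[R]_p) -> T -> 'cV[R]_q)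
  (res : (nat -> T -> 'cV[R]_p) -> T -> 'cV[R]_r) (k : nat)
  (N : 'M[R]_(q, r) -> 'M[R]_(q, p)) (E : 'M[R]_(q, r) -> 'cV[V]_q).
Hypothesis errE : forall W d t,
  x d t - (b d t + W *m res d t) = N W *m d k t + ev (E W) t.

Lemma unbiased_gain_affine W : unbiased_gain P x b res W <-> N W = 0.
Proof.
split=> [unb|NW d _].
  apply: (@zero_mean_affine _ _ _ (E W) k) => d /unb.
  by under eq_fun => t do rewrite errE.
under eq_fun => t do rewrite errE NW mul0mx add0r.
exact: ev_zero_mean.
Qed.

Lemma error_unbiased_gain W d : N W = 0 ->
  (fun t => x d t - (b d t + W *m res d t)) = ev (E W).
Proof. by move=> NW; apply/funext => t; rewrite errE NW mul0mx add0r. Qed.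

Lemma MVU_gain_affine W : N W = 0 ->
  (forall W', N W' = 0 -> \tr (Cov (E W) (E W)) <= \tr (Cov (E W') (E W'))) ->
  MVU_gain P x b res W.
Proof.
move=> NW opt; split=> [|W' /unbiased_gain_affine NW' d _].
  exact/unbiased_gain_affine.
by rewrite !error_unbiased_gain// !ev_trace_cov lee_fin opt.
Qed.

Lemma BLUE_gain_affine W : b = (fun _ _ => 0) -> N W = 0 ->
  (forall W', N W' = 0 -> \tr (Cov (E W) (E W)) <= \tr (Cov (E W') (E W'))) ->
  BLUE_gain P x res W.
Proof.
move=> b0 NW opt; rewrite /BLUE_gain -b0.
split=> [|W' /unbiased_gain_affine NW' d _]; first exact/unbiased_gain_affine.
have mseE W'' : N W'' = 0 ->
    mse P (fun t => x d t - W'' *m res d t) = (\tr (Cov (E W'') (E W'')))%:E.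
  move=> NW''; rewrite -ev_mse -(error_unbiased_gain d NW'') b0.
  by congr mse; apply/funext => t; rewrite add0r.
by rewrite !mseE// lee_fin opt.
Qed.

End AffineErrors.

End Unbiasedness.

(** Independence is assumed for x, while the error is x - c: the shift by c
    is absorbed in the Borel sets. *)
Lemma indep_uncorrelated (dsp : measure_display) (T : measurableType dsp) (R : realType)
  (P : probability T R) q r (X : 'cV[cvar P]_q) (Y : 'cV[cvar P]_r)
  (x : T -> 'cV[R]_q) (c : 'cV[R]_q) :
  (forall t, x t - c = ev X t) -> independent_vec P x (ev Y) -> Cov X Y = 0.
Proof.
move=> xE ind; apply/matrixP => i j; rewrite !mxE; apply: EFin_inj.
rewrite ip_EFin expectation_mul_indep ?cvar_L2 ?cvar_E ?mule0// => A B mA mB.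
have XE t : X i 0 t = x t i 0 - c i 0.
  by have /(congr1 (fun M : 'cV[R]_q => M i 0)) := xE t; rewrite !mxE => ->.
have cm : measurable_fun [set: R] (fun z : R => z - c i 0).
  by apply: measurable_funB.
have mA' : measurable ((fun z : R => z - c i 0) @^-1` A).
  by have := cm measurableT A mA; rewrite setTI.
have preE : (X i 0 : T -> R) @^-1` A =
    (fun t => x t i 0) @^-1` ((fun z : R => z - c i 0) @^-1` A).
  by apply/seteqP; split=> t /=; rewrite XE.
rewrite preE; apply: ind.
  by apply: sub_gen_smallest; exists i, ((fun z : R => z - c i 0) @^-1` A).
apply: sub_gen_smallest; exists j, B; split=> //.
by apply/seteqP; split=> t /=; rewrite mxE.
Qed.

Theorem lemma8 (dsp : measure_display) (T : measurableType dsp) (R : realType)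
  (P : probability T R) (n m p l : nat)
  (S : @system R n m p l) (s : svd_factors (sysH S))
  (u : nat -> 'cV[R]_m) (x0 : T -> 'cV[R]_n)
  (w : nat -> T -> 'cV[R]_n) (v : nat -> T -> 'cV[R]_l)
  (xhat0 : 'cV[R]_n) (P0 : 'M[R]_n)
  (Hsys : system_assumptions S)
  (Hsvd : is_svd s)
  (Hnoise : noise_assumptions P S x0 w v)
  (Hx0 : L2_vec P x0)
  (Hunb : zero_mean P (fun t => x0 t - xhat0))
  (HP0 : has_cov P (fun t => x0 t - xhat0) (fun t => x0 t - xhat0) P0)
  (Hrk : forall k, \rank (C2 s k.+1 *m G2 s k) = (p - \rank (sysH S k))%N) :
  forall a : algorithm,
    optimal_filter P u x0 w v s xhat0 a (algorithm_gains s P0 a).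
Proof.
move=> a; case: Hsys => _ _ _ _ HR.
case: Hnoise => L2 mean0 cov covwv ind.
have [e0 e0E] : exists e0 : 'cV[cvar P]_n, ev e0 = fun t => x0 t - xhat0.
  apply: ev_surj => // i.
  rewrite (_ : (fun t => _) = (fun t => x0 t i 0) - cst (xhat0 i 0)); last first.
    by apply/funext => t; rewrite !mxE.
  rewrite addrC -scaleN1r; apply: (Lfun_submod_closed P _).2 => //.
    by rewrite lee1n.
  exact: Lfun_cst.
have /choice[wV wVE] : forall k, exists E : 'cV[cvar P]_n, ev E = w k.
  by move=> k; apply: ev_surj; [exact: (L2 k).1|exact: (mean0 k).1].
have /choice[vV vVE] : forall k, exists E : 'cV[cvar P]_l, ev E = v k.
  by move=> k; apply: ev_surj; [exact: (L2 k).2|exact: (mean0 k).2].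
have x0E t : x0 t - xhat0 = ev e0 t by rewrite e0E.
have wE k t : w k t = ev (wV k) t by rewrite wVE.
have vE k t : v k t = ev (vV k) t by rewrite vVE.
have e0e0 : Cov e0 e0 = P0 by apply: has_cov_Cov; rewrite e0E.
have e0w k : Cov e0 (wV k) = 0.
  by apply: (indep_uncorrelated x0E); rewrite wVE; exact: (ind k).1.
have e0v k : Cov e0 (vV k) = 0.
  by apply: (indep_uncorrelated x0E); rewrite vVE; exact: (ind k).2.
have wv j k : Cov (wV j) (vV k) = 0 by apply: has_cov_Cov; rewrite wVE vVE.
have ww j k : Cov (wV j) (wV k) = if j == k then sysQ S k else 0.
  by apply: has_cov_Cov; rewrite !wVE; exact: (cov j k).1.
have vv j k : Cov (vV j) (vV k) = if j == k then sysR S k else 0.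
  by apply: has_cov_Cov; rewrite !vVE; exact: (cov j k).2.
set g := algorithm_gains s P0 a.
have g1 k : M1gain g k = M1 s k by rewrite M1_alg.
have g2 k : M2gain g k *m (C2 s k.+1 *m G2 s k) = 1%:M.
  exact: (alg_M2_unbiased Hsvd HR Hrk e0e0 e0w e0v wv ww vv a k).
have gL k : Lgain g k.+1 *m svdU1 s k.+1 = 0.
  exact: (alg_L_unbiased Hsvd HR Hrk e0e0 e0w e0v wv ww vv a k).
have ok d t k := err_okP Hsvd u x0E wE vE d t a g1 g2 gL k.
split.
- move=> k d _; under eq_fun => t do rewrite (ok d t k).2.
  exact: ev_zero_mean.
- move=> k d _; under eq_fun => t do
    rewrite (dhat_error Hsvd u x0E wE vE d t a g1 g2 gL k).
  exact: ev_zero_mean.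
- move=> k.
  apply: (@BLUE_gain_affine _ _ _ P _ _ _ _ (fun _ _ => 0) _ k
    (fun W => (svdV1 s k)^T - W *m svdS s k *m (svdV1 s k)^T)
    (fun W => - (W ** noise1 s e0 wV vV a g k))) => //.
  + by move=> W d t; rewrite add0r (d1_error Hsvd vE W (ok d t k)).
  + by rewrite g1 mulVmx ?svd_S_unit// mul1mx subrr.
  (* unbiasedness leaves a single gain for d_1, since Sigma is invertible *)
  + move=> W NW; suff -> : W = M1gain g k by [].
    have [V11 _ _ _] := svd_V_blocks Hsvd k.
    have := congr1 (fun M => M *m svdV1 s k) NW.
    rewrite mulmxBl -!mulmxA V11 mulmx1 mul0mx => /eqP.
    rewrite subr_eq0 => /eqP WS.
    by rewrite g1 -[W](mulmxK (svd_S_unit Hsvd k)) -WS mul1mx.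
- move=> k.
  apply: (@BLUE_gain_affine _ _ _ P _ _ _ _ (fun _ _ => 0) _ k
    (fun W => (svdV2 s k)^T - W *m (C2 s k.+1 *m G2 s k) *m (svdV2 s k)^T)
    (fun W => - (W ** noise2 s vV k (prederr s wV vV a g k (err s e0 wV vV a g k))))) => //.
  + by move=> W d t; rewrite add0r (d2_error Hsvd wE vE g1 W (ok d t k)).
  + by rewrite g2 mul1mx subrr.
  + move=> W NW; apply: (alg_M2_optimal Hsvd HR Hrk e0e0 e0w e0v wv ww vv).
    have [_ _ _ V22] := svd_V_blocks Hsvd k.
    have := congr1 (fun M => M *m svdV2 s k) NW.
    rewrite mulmxBl -(mulmxA _ _ (svdV2 s k)) V22 mulmx1 mul0mx => /eqP.
    by rewrite subr_eq0 => /eqP.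
- move=> k.
  apply: (@MVU_gain_affine _ _ _ P _ _ _ _ _ _ k.+1
    (fun W => - (W *m sysH S k.+1))
    (fun W => (err s e0 wV vV a g k.+1).1
       - W ** (sysC S k.+1 ** (err s e0 wV vV a g k.+1).1 + vV k.+1))).
  + by move=> W d t; rewrite (state_error vE W (ok d t k.+1).1).
  + by rewrite ((gain_H0 Hsvd _ _).2 (gL k)) oppr0.
  + move=> W /eqP; rewrite oppr_eq0 => /eqP /(gain_H0 Hsvd _ _) WU.
    exact: (alg_L_optimal Hsvd HR Hrk e0e0 e0w e0v wv ww vv).
Qed.
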